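(* Let $p,q\ge 0$. Let $f_1,f_2,\dots,f_n\in\Theta$ have pairwise identical or disjoint supports, let $I_1<I_2<\dots<I_r$ be the distinct intervals occurring among the supports of $f_1,\dots,f_n$, and let $b_i=\frac12\,|\{j:\ \mathrm{supp}\,f_j=I_i\}|$ for $i=1,\dots,r$. Then $$\varphi(\omega(f_1)\omega(f_2)\cdots\omega(f_n))=\prod_{i=1}^{r}\frac{(\lambda(I_i))^{b_i}}{b_i!}\ \sum_{\substack{P\in\mathcal{ONC}_n^2\\ P\sim(f_1,\dots,f_n)}}w(P),$$ where the right-hand side is understood to be $0$ when the sum is empty (in particular when some $b_i$ is not an integer).
   Context: Combinatorics. A partition of $[n]=\{1,\dots,n\}$ is non-crossing if there are no $k<m<k'<m'$ with $k,k'$ in one block and $m,m'$ in a different block. For distinct blocks $B,B'$ of a non-crossing partition write $B<B'$ ($B'$ is inner with respect to $B$) if there are $a,b\in B$ with $a<c<b$ for all $c\in B'$; write $B\prec B'$ if $B<B'$ and there is no block $B''$ with $B<B''<B'$. An ordered non-crossing partition of $[n]$ is a sequence $P=(P_1,\dots,P_k)$ listing all blocks of a non-crossing partition of $[n]$, each exactly once, in an arbitrary order; $\mathcal{ONC}_n^2$ is the set of those all of whose blocks have two elements (empty if $n$ is odd). Let $e(P)$ be the number of pairs $i<j$ with $P_j\prec P_i$, $e'(P)$ the number of pairs $i<j$ with $P_i\prec P_j$, and $w(P)=p^{e(P)}q^{e'(P)}$, with $0^0=1$. Functions. $\Theta=\{\chi_{[s,t)}:0\le s<t<\infty\}$, and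 the support of $\chi_{[s,t)}$ means the interval $[s,t)$. For intervals, $I<J$ means $x<y$ for all $x\in I,y\in J$, and $I\le J$ means $I<J$ or $I=J$; for $f,g\in\Theta$, $f<g$ (resp. $f\le g$) means the same relation between supports. $\lambda$ is Lebesgue measure. An ordered partition $P=(P_1,\dots,P_m)$ of $[n]$ is adapted to $(f_1,\dots,f_n)$, written $P\sim(f_1,\dots,f_n)$, if (1) $i,j\in P_k$ implies $f_i=f_j$, and (2) $i\in P_k$, $j\in P_l$, $k<l$ imply $f_i\le f_j$. Operators. Let $\mathcal{H}=L^2(\mathbb{R}_+)$ and let $\mathcal{F}(\mathcal{H})=\mathbb{C}\Omega\oplus\bigoplus_{n\ge1}L^2(\mathbb{R}_+^n)$ be the free Fock space with its canonical inner product (linear in the first variable). Let $w(s,t)=p$ if $0<s<t$, $w(s,t)=q$ if $0<t<s$, and $w(s,t)=1$ otherwise. For $f_1,\dots,f_n\in\mathcal{H}$ let $(f_1\circledast\cdots\circledast f_n)(t_1,\dots,t_n)=f_1(t_1)\sqrt{w(t_1,t_2)}f_2(t_2)\cdots\sqrt{w(t_{n-1},t_n)}f_n(t_n)$. The $(p,q)$-creation operator $a(f)$, $f\in\mathcal{H}$, is the bounded linear extension of $a(f)\Omega=f$, $a(f)(f_1\circledast\cdots\circledast f_n)=f\circledast f_1\circledast\cdots\circledast f_n$; explicitly $(a(f)F)(t_1,\dots,t_{n+1})=f(t_1)\sqrt{w(t_1,t_2)}F(t_2,\dots,t_{n+1})$ for $F\in L^2(\mathbb{R}_+^n)$, $n\ge1$.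 $a^*(f)$ is the adjoint of $a(f)$, $\omega(f)=a(f)+a^*(f)$, and $\varphi(T)=\langle T\Omega,\Omega\rangle$ is the vacuum state. *)

(* Defs.v *)
From HB Require Import structures.
From mathcomp Require Import all_boot all_order all_algebra.
Set Implicit Arguments.
Unset Strict Implicit.
Unset Printing Implicit Defensive.
Import Order.TTheory GRing.Theory Num.Theory.
Local Open Scope ring_scope.

Section combinatorics.
Variable n : nat.
Implicit Types (S : {set {set 'I_n}}) (B : {set 'I_n}) (P : seq {set 'I_n}).

Definition noncrossing S : bool :=
  [forall B in S, forall B' in S, (B != B') ==>
    ~~ [exists k in B, exists m in B', exists k' in B, exists m' in B',
          [&& (k < m)%N, (m < k')%N & (k' < m')%N]]].

(* inner_lt B B' is B < B': the block B' is inner with respect to B. *)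
Definition inner_lt B B' : bool :=
  [exists a in B, exists b in B, forall c in B', (a < c)%N && (c < b)%N].

(* The covering relation of inner_lt among the blocks in S. *)
Definition inner_cover S B B' : bool :=
  inner_lt B B' && ~~ [exists B'' in S, inner_lt B B'' && inner_lt B'' B'].

Definition ONC P : bool :=
  [&& uniq P, partition [set:: P] [set: 'I_n] & noncrossing [set:: P]].

Definition ONC2 P : bool := ONC P && all (fun B => #|B| == 2%N) P.

(* Pairs i < j with P_j covering P_i. *)
Definition stat_e P : nat :=
  #|[set ij : 'I_(size P) * 'I_(size P) | (ij.1 < ij.2)%N &&
      inner_cover [set:: P] (nth set0 P ij.2) (nth set0 P ij.1)]|.

(* Pairs i < j with P_i covering P_j. *)
Definition stat_e' P : nat :=
  #|[set ij : 'I_(size P) * 'I_(size P) | (ij.1 < ij.2)%N &&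
      inner_cover [set:: P] (nth set0 P ij.1) (nth set0 P ij.2)]|.

Definition weight (R : numDomainType) (p q : R) P : R :=
  p ^+ stat_e P * q ^+ stat_e' P.

End combinatorics.

From mathcomp Require Import ring.
From mathcomp Require Import complex.
From mathcomp Require Import all_classical all_reals all_analysis.
From mathcomp Require Import measurable_realfun.
Import numFieldNormedType.Exports.

Local Open Scope classical_set_scope.
Local Open Scope complex_scope.

Section intervals.
Variable R : realType.

Definition set_lt (I J : set R) : Prop :=
  forall x y, I x -> J y -> x < y.

Definition set_le (I J : set R) : Prop := set_lt I J \/ I = J.

(* The pair (s, t) stands for the indicator function of [s, t), see chi. *)
Definition Theta := {st : R * R | 0 <= st.1 < st.2}.

Definition supp (f : Theta) : set R := [set x | (val f).1 <= x < (val f).2].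

Lemma suppE (f : Theta) : supp f = `[(val f).1, (val f).2[.
Proof. by apply/seteqP; split => x; rewrite /supp/= in_itv. Qed.

Definition chi (f : Theta) : R -> R := \1_(supp f).

Definition adapted n (f : 'I_n -> Theta) (P : seq {set 'I_n}) : Prop :=
  (forall B i j, B \in P -> i \in B -> j \in B -> chi (f i) = chi (f j)) /\
  (forall k l i j, (k < l < size P)%N ->
     i \in nth finset.set0 P k -> j \in nth finset.set0 P l ->
     set_le (supp (f i)) (supp (f j))).

End intervals.

Definition sqnorm (R : realType) (z : R[i]) : R := (Re z) ^+ 2 + (Im z) ^+ 2.

Definition cmeasurable d (T : measurableType d) (R : realType) (F : T -> R[i]) :=
  measurable_fun [set: T] (fun x => Re (F x)) /\
  measurable_fun [set: T] (fun x => Im (F x)).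

(* The squared L^2 norm, +oo allowed. *)
Definition sqint d (T : measurableType d) (R : realType)
    (mu : {measure set T -> \bar R}) (F : T -> R[i]) : \bar R :=
  (\int[mu]_x (sqnorm (F x))%:E)%E.

Definition cintegral d (T : measurableType d) (R : realType)
    (mu : {measure set T -> \bar R}) (F : T -> R[i]) : R[i] :=
  (\int[mu]_x Re (F x)) +i* (\int[mu]_x Im (F x)).

Section complex_valued.
Context d (T : measurableType d) (R : realType).
Implicit Types (F G : T -> R[i]) (z : R[i]).

Lemma sqnorm_ge0 z : 0 <= sqnorm z.
Proof. by rewrite addr_ge0 ?sqr_ge0. Qed.

Lemma sqnorm0 : sqnorm (0 : R[i]) = 0.
Proof. by rewrite /sqnorm/= expr0n addr0. Qed.

Lemma sqnormC (r : R) : sqnorm r%:C = r ^+ 2.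
Proof. by rewrite /sqnorm/= expr0n addr0. Qed.

Lemma sqnormM y z : sqnorm (y * z) = sqnorm y * sqnorm z.
Proof. by case: y z => [a b] [c e]; rewrite /sqnorm/=; ring. Qed.

Lemma sqnormD y z : sqnorm (y + z) <= 2 * sqnorm y + 2 * sqnorm z.
Proof.
case: y z => [a b] [c e]; rewrite /sqnorm/= -subr_ge0.
rewrite [leRHS](_ : _ = (a - c) ^+ 2 + (b - e) ^+ 2); last by ring.
by rewrite addr_ge0 ?sqr_ge0.
Qed.

Lemma cmeasurable_cst z : cmeasurable (fun _ : T => z).
Proof. by split; exact: measurable_cst. Qed.

Lemma cmeasurable_real (h : T -> R) :
  measurable_fun [set: T] h -> cmeasurable (fun x => (h x)%:C).
Proof. by move=> mh; split => //=; exact: measurable_cst. Qed.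

Lemma cmeasurableD F G :
  cmeasurable F -> cmeasurable G -> cmeasurable (fun x => F x + G x).
Proof.
move=> [rF iF] [rG iG]; split.
- rewrite [X in measurable_fun _ X](_ : _ = (fun x => Re (F x) + Re (G x))).
    exact: measurable_funD.
  by apply/funext => x; case: (F x) (G x) => [a b] [c e].
- rewrite [X in measurable_fun _ X](_ : _ = (fun x => Im (F x) + Im (G x))).
    exact: measurable_funD.
  by apply/funext => x; case: (F x) (G x) => [a b] [c e].
Qed.

Lemma cmeasurableM F G :
  cmeasurable F -> cmeasurable G -> cmeasurable (fun x => F x * G x).
Proof.
move=> [rF iF] [rG iG]; split.
- rewrite [X in measurable_fun _ X](_ : _ = (fun x =>
    Re (F x) * Re (G x) - Im (F x) * Im (G x))).
    by apply: measurable_funB; exact: measurable_funM.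
  by apply/funext => x; case: (F x) (G x) => [a b] [c e].
- rewrite [X in measurable_fun _ X](_ : _ = (fun x =>
    Re (F x) * Im (G x) + Im (F x) * Re (G x))).
    by apply: measurable_funD; exact: measurable_funM.
  by apply/funext => x; case: (F x) (G x) => [a b] [c e].
Qed.

Lemma measurable_sqnorm F :
  cmeasurable F -> measurable_fun [set: T] (fun x => (sqnorm (F x))%:E).
Proof.
move=> [rF iF]; apply/measurable_EFinP.
by apply: measurable_funD; exact: measurable_funX.
Qed.

Lemma sqint_ge0 (mu : {measure set T -> \bar R}) F : (0 <= sqint mu F)%E.
Proof. by apply: integral_ge0 => x _; rewrite lee_fin sqnorm_ge0. Qed.

Lemma sqint0 (mu : {measure set T -> \bar R}) : sqint mu (fun=> 0) = 0%E.
Proof. by apply: integral0_eq => x _; rewrite sqnorm0. Qed.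

Lemma sqintD (mu : {measure set T -> \bar R}) F G :
  cmeasurable F -> cmeasurable G ->
  (sqint mu (fun x => (F x + G x)%R)
    <= 2%:E * sqint mu F + 2%:E * sqint mu G)%E.
Proof.
move=> mF mG; have sF := measurable_sqnorm mF; have sG := measurable_sqnorm mG.
have pos (H : T -> R[i]) x : [set: T] x -> (0 <= (sqnorm (H x))%:E)%E.
  by move=> _; rewrite lee_fin sqnorm_ge0.
have s2 (H : T -> R[i]) : cmeasurable H ->
    (2%:E * sqint mu H = \int[mu]_x (2%:E * (sqnorm (H x))%:E))%E.
  move=> mH; rewrite /sqint ge0_integralZl_EFin//; first exact: pos.
  exact: measurable_sqnorm.
rewrite !s2// -ge0_integralD//; first last.
- exact: measurable_funeM.
- by move=> x _; rewrite mule_ge0// pos.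
- exact: measurable_funeM.
- by move=> x _; rewrite mule_ge0// pos.
apply: ge0_le_integral => //.
- exact: (pos (fun x => F x + G x)).
- by apply: (measurable_sqnorm (F := fun x => F x + G x)); exact: cmeasurableD.
- by apply: emeasurable_funD; exact: measurable_funeM.
- by move=> x _; rewrite -!EFinM -EFinD lee_fin sqnormD.
Qed.

End complex_valued.

Lemma product_sigma_finite d1 d2 (T1 : measurableType d1) (T2 : measurableType d2)
    (R : realType) (m1 : {sigma_finite_measure set T1 -> \bar R})
    (m2 : {sigma_finite_measure set T2 -> \bar R}) :
  sigma_finite setT (m1 \x m2)%E.
Proof.
have /sigma_finiteP[F [TF ndF Foo]] := sigma_finiteT m1.
have /sigma_finiteP[G [TG ndG Goo]] := sigma_finiteT m2.
exists (fun n => F n `*` G n).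
  rewrite -setXTT TF TG predeqE => -[x y]; split.
    move=> [/= [n _ Fnx] [k _ Gky]]; exists (maxn n k) => //; split.
    - by move: x Fnx; exact/subsetPset/ndF/leq_maxl.
    - by move: y Gky; exact/subsetPset/ndG/leq_maxr.
  by move=> [n _ []/= ? ?]; split; exists n.
move=> k; have [? ?] := Foo k; have [? ?] := Goo k.
split; first exact: measurableX.
by rewrite product_measure1E// lte_mul_pinfty// ge0_fin_numE.
Qed.

Section fock_space.
Variable R : realType.
Local Notation RR := (measurableTypeR R).

Lemma measurable_half_line : measurable (`[0, +oo[ : set RR).
Proof. by []. Qed.

Definition lebesgue_restr := mrestr (@lebesgue_measure R) measurable_half_line.

HB.instance Definition _ := Measure.on lebesgue_restr.

Let lebesgue_restr_sigma_finite : sigma_finite setT lebesgue_restr.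
Proof.
have [F TF Fm] := sigma_finiteT (@lebesgue_measure R); exists F => // k.
have [mFk Fk] := Fm k; split => //; apply: le_lt_trans Fk.
apply: le_measure; rewrite ?inE//.
by apply: measurableI => //; exact: measurable_half_line.
Qed.

HB.instance Definition _ :=
  Measure_isSigmaFinite.Build _ _ _ lebesgue_restr lebesgue_restr_sigma_finite.

(* R_+ is modelled by R carrying Lebesgue measure restricted to [0, +oo[. *)
Definition mu_half : {sigma_finite_measure set RR -> \bar R} := lebesgue_restr.

Definition tcons n (x : RR * n.-tuple RR) : n.+1.-tuple RR :=
  [tuple of x.1 :: x.2].

Lemma measurable_tcons n : measurable_fun setT (@tcons n).
Proof. exact: (measurable_cons measurable_fst measurable_snd). Qed.

Definition mu_cons n (nu : {sigma_finite_measure set (n.-tuple RR) -> \bar R})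
  := pushforward (mu_half \x nu)%E (@tcons n).

Section mu_cons_sigma_finite.
Context n (nu : {sigma_finite_measure set (n.-tuple RR) -> \bar R}).
Local Open Scope ereal_scope.

Let mtpre (A : set (n.+1.-tuple RR)) :
  measurable A -> measurable (@tcons n @^-1` A).
Proof. by move=> mA; rewrite -[X in measurable X]setTI; exact: measurable_tcons. Qed.

Let mu_cons0 : mu_cons nu set0 = 0.
Proof. by rewrite /mu_cons /pushforward preimage_set0 measure0. Qed.

Let mu_cons_ge0 A : 0 <= mu_cons nu A.
Proof. by rewrite /mu_cons /pushforward; exact: measure_ge0. Qed.

Let mu_cons_sigma_additive : semi_sigma_additive (mu_cons nu).
Proof.
move=> F mF tF mUF; rewrite /mu_cons /pushforward preimage_bigcup.
apply: measure_semi_sigma_additive.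
- by move=> k; exact: mtpre.
- apply/trivIsetP => i j _ _ ij; rewrite -preimage_setI.
  by move/trivIsetP : tF => /(_ _ _ _ _ ij) ->//; rewrite preimage_set0.
- by rewrite -preimage_bigcup; exact: mtpre.
Qed.

HB.instance Definition _ := isMeasure.Build _ _ _ (mu_cons nu)
  mu_cons0 mu_cons_ge0 mu_cons_sigma_additive.

Let mu_cons_sigma_finite : sigma_finite setT (mu_cons nu).
Proof.
have [F TF Fm] := product_sigma_finite mu_half nu.
pose u (t : n.+1.-tuple RR) : RR * n.-tuple RR := (thead t, [tuple of behead t]).
have mu : measurable_fun setT u.
  apply/measurable_fun_pairP; split; last exact: measurable_behead.
  exact: measurable_tnth.
have uK x : u (tcons x) = x.
  by case: x => x t; congr pair; apply/val_inj.
exists (fun k => u @^-1` F k).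
  by apply/esym; rewrite -preimage_bigcup -TF preimage_setT.
move=> k; have [mFk Fk] := Fm k; split.
  by rewrite -[X in measurable X]setTI; exact: mu.
rewrite /mu_cons /pushforward.
by rewrite (_ : _ @^-1` _ = F k)//; apply/seteqP; split => x /=; rewrite uK.
Qed.

HB.instance Definition _ :=
  Measure_isSigmaFinite.Build _ _ _ (mu_cons nu) mu_cons_sigma_finite.

End mu_cons_sigma_finite.

(* The n-fold product of mu_half, moved along the bijection
   R * R^n -> R^(n+1); on the one-point space R^0 it is the Dirac mass, so that
   L^2 of mu_tuple 0 is C. *)
Fixpoint mu_tuple n : {sigma_finite_measure set (n.-tuple RR) -> \bar R} :=
  if n is m.+1 then mu_cons (mu_tuple m) else \d_([tuple] : 0.-tuple RR).

(* Representatives of elements of L^2(R_+). *)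
Record L2 := MkL2 {
  L2_fun :> RR -> R[i] ;
  L2_measurable : cmeasurable L2_fun ;
  L2_finite : (sqint mu_half L2_fun < +oo)%E }.

Lemma chi_measurable (f : Theta R) :
  cmeasurable (fun x : RR => (chi f x)%:C).
Proof.
apply: cmeasurable_real.
apply: (@measurable_indic _ RR R setT (supp f)).
by rewrite suppE; exact: measurable_itv.
Qed.

Lemma chi_finite (f : Theta R) :
  (sqint mu_half (fun x : RR => (chi f x)%:C) < +oo)%E.
Proof.
have mS : measurable (supp f : set RR) by rewrite suppE.
rewrite /sqint (eq_integral (fun x : RR => (\1_(supp f) x)%:E)); last first.
  move=> x _; rewrite sqnormC /chi indicE.
  by case: (_ \in _); rewrite ?expr1n ?expr0n.
rewrite integral_indic// setIT /=.
apply: (@le_lt_trans _ _ (@lebesgue_measure R (supp f))).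
  by apply: le_measure; rewrite ?inE//; exact: measurableI.
by rewrite suppE lebesgue_measure_itv/=; case: ifP => _; rewrite ?ltry.
Qed.

Definition chi_L2 (f : Theta R) : L2 := MkL2 (chi_measurable f) (chi_finite f).

(* Representatives of elements of the Hilbert direct sum of the L^2(R_+^n),
   n >= 0; the summand n = 0 is the vacuum line. *)
Record fock_fun := MkFockFun {
  fock_component :> forall n, n.-tuple RR -> R[i] ;
  fock_measurable : forall n, cmeasurable (@fock_component n) ;
  fock_finite :
    (\sum_(0 <= n <oo) sqint (mu_tuple n) (@fock_component n) < +oo)%E }.
Arguments fock_component : clear implicits.

HB.instance Definition _ := gen_eqMixin fock_fun.
HB.instance Definition _ := gen_choiceMixin fock_fun.

Definition fock_ae (F G : fock_fun) : bool :=
  `[< forall n, {ae mu_tuple n, forall x, F n x = G n x} >].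

Let fock_ae_refl : reflexive fock_ae.
Proof. by move=> F; apply/asboolP => n; apply/nearW. Qed.

Let fock_ae_sym : symmetric fock_ae.
Proof.
by move=> F G; apply/idP/idP => /asboolP FG; apply/asboolP => n;
  apply: filterS (FG n) => x ->.
Qed.

Let fock_ae_trans : transitive fock_ae.
Proof.
move=> F G H /asboolP GF /asboolP FH; apply/asboolP => n.
by apply: filterS2 (GF n) (FH n) => x -> ->.
Qed.

Canonical fock_ae_equiv :=
  EquivRel fock_ae fock_ae_refl fock_ae_sym fock_ae_trans.

Local Open Scope quotient_scope.

(* The free Fock space: square-summable sequences modulo equality a.e. *)
Definition fock : Type := {eq_quot fock_ae}.
HB.instance Definition _ := Choice.on fock.
HB.instance Definition _ := EqQuotient.on fock.

(* Linear in the first variable. Both series converge absolutely by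
   Cauchy-Schwarz. *)
Definition inner (F G : fock) : R[i] :=
  let c n := cintegral (mu_tuple n) (fun x => repr F n x * (repr G n x)^*) in
  limn (series (fun n => Re (c n))) +i* limn (series (fun n => Im (c n))).

Definition vacuum_fun n (_ : n.-tuple RR) : R[i] := (n == 0%N)%:R.

Lemma vacuum_measurable n : cmeasurable (@vacuum_fun n).
Proof. exact: cmeasurable_cst. Qed.

Lemma vacuum_finite :
  (\sum_(0 <= n <oo) sqint (mu_tuple n) (@vacuum_fun n) < +oo)%E.
Proof.
rewrite nneseries_recl//; last by move=> n _; exact: sqint_ge0.
rewrite eseries0 ?adde0; last first.
  by move=> [//|n] _ _; rewrite /vacuum_fun/= sqint0.
rewrite /sqint integral_dirac// ?diracT ?mul1e ?ltry//.
apply: measurable_sqnorm; exact: cmeasurable_cst.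
Qed.

Definition vacuum : fock :=
  \pi_fock (MkFockFun vacuum_measurable vacuum_finite).

Lemma fock_add_finite (F G : fock_fun) :
  (\sum_(0 <= n <oo) sqint (mu_tuple n) (fun x => F n x + G n x)%R < +oo)%E.
Proof.
apply: (@le_lt_trans _ _ (\sum_(0 <= n <oo)
  (2%:E * sqint (mu_tuple n) (F n) + 2%:E * sqint (mu_tuple n) (G n))))%E.
  apply: lee_nneseries => [n _ _|n _]; first exact: sqint_ge0.
  by apply: sqintD; exact: fock_measurable.
rewrite nneseriesD; [|by move=> n _ _; rewrite mule_ge0 ?sqint_ge0..].
rewrite !nneseriesZl; [|by move=> n _; exact: sqint_ge0..].
by rewrite lte_add_pinfty// lte_mul_pinfty//; exact: fock_finite.
Qed.

Definition fock_add (F G : fock) : fock :=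
  \pi_fock (MkFockFun
    (fun n => cmeasurableD (fock_measurable (repr F) n)
                           (fock_measurable (repr G) n))
    (fock_add_finite (repr F) (repr G))).

Variables p q : R.

Definition w (s t : R) : R :=
  if 0 < s < t then p else if 0 < t < s then q else 1.

(* The factor depending on the first two variables; 1 if there is only one. *)
Definition sqrt_w (t : seq R) : R :=
  if t is t1 :: t2 :: _ then Num.sqrt (w t1 t2) else 1.

Definition creation_fun (f : RR -> R[i]) (F : fock_fun) n :
    n.-tuple RR -> R[i] :=
  if n is m.+1 then fun t => f (thead t) * (sqrt_w t)%:C * F m [tuple of behead t]
  else fun=> 0.

Lemma measurable_sqrt_w n : measurable_fun setT (fun t : n.-tuple RR => sqrt_w t).
Proof.
case: n => [|[|n]].
- rewrite (_ : (fun _ => _) = cst 1); first exact: measurable_cst.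
  by apply/funext => t; rewrite tuple0.
- rewrite (_ : (fun _ => _) = cst 1); first exact: measurable_cst.
  by apply/funext => t; case: t => [[//|x [|//]]].
pose t1 (t : n.+2.-tuple RR) : R := tnth t ord0.
pose t2 (t : n.+2.-tuple RR) : R := tnth t (lift ord0 ord0).
have m1 : measurable_fun setT t1 by exact: measurable_tnth.
have m2 : measurable_fun setT t2 by exact: measurable_tnth.
have m0 : measurable_fun [set: n.+2.-tuple RR] (fun=> 0 : R).
  exact: measurable_cst.
rewrite (_ : (fun _ => _) = (fun t : n.+2.-tuple RR =>
    if (0 < t1 t) && (t1 t < t2 t) then Num.sqrt p
    else if (0 < t2 t) && (t2 t < t1 t) then Num.sqrt q else 1)).
  apply: measurable_fun_ifT; [|exact: measurable_cst|].
    by apply: measurable_and; exact: measurable_fun_ltr.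
  apply: measurable_fun_ifT; [|exact: measurable_cst|exact: measurable_cst].
  by apply: measurable_and; exact: measurable_fun_ltr.
apply/funext => t; rewrite /t1 /t2.
case: t => [[//|x [//|y s]]] /= st.
by rewrite !(tnth_nth 0)/= /w !(fun_if Num.sqrt) sqrtr1.
Qed.

Lemma measurable_creation (f : L2) (F : fock_fun) n :
  cmeasurable (creation_fun f F (n := n)).
Proof.
case: n => [|n]; first exact: cmeasurable_cst.
apply: cmeasurableM; last first.
  have [rF iF] := fock_measurable F n.
  split; first exact: (measurableT_comp rF (@measurable_behead _ RR n)).
  exact: (measurableT_comp iF (@measurable_behead _ RR n)).
apply: cmeasurableM; last first.
  exact: (cmeasurable_real (@measurable_sqrt_w n.+1)).
have [rf imf] := L2_measurable f.
split; first exact: (measurableT_comp rf (@measurable_tnth _ RR _ ord0)).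
exact: (measurableT_comp imf (@measurable_tnth _ RR _ ord0)).
Qed.

Let wmax : R := `|p| + `|q| + 1.

Lemma sqr_sqrt_w_le (t : seq R) : sqrt_w t ^+ 2 <= wmax.
Proof.
have bound (x : R) : Num.sqrt x ^+ 2 <= `|x|.
  have [x0|x0] := leP 0 x; first by rewrite sqr_sqrtr// ler_norm.
  by rewrite ltr0_sqrtr// expr0n/= normr_ge0.
have le1 : 1 <= wmax by rewrite lerDr addr_ge0.
have lep : `|p| <= wmax by rewrite /wmax -addrA lerDl addr_ge0.
have leq : `|q| <= wmax.
  by rewrite /wmax [`|p| + _]addrC -addrA lerDl addr_ge0.
rewrite /sqrt_w; case: t => [|x [|y t]]; rewrite ?expr1n//.
rewrite /w; case: ifP => _; first exact: (le_trans (bound _) lep).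
by case: ifP => _; [exact: (le_trans (bound _) leq)|rewrite sqrtr1 expr1n].
Qed.

Lemma sqint_creation (f : L2) (F : fock_fun) n :
  (sqint (mu_tuple n.+1) (creation_fun f F (n := n.+1))
    <= wmax%:E * sqint mu_half f * sqint (mu_tuple n) (F n))%E.
Proof.
have pos d (T : measurableType d) (H : T -> R[i]) x :
  [set: T] x -> (0 <= (sqnorm (H x))%:E)%E.
  by move=> _; rewrite lee_fin sqnorm_ge0.
have M0 : 0 <= wmax by rewrite !addr_ge0.
have mf := measurable_sqnorm (L2_measurable f).
have mF := measurable_sqnorm (fock_measurable F n).
have mc := measurable_sqnorm (measurable_creation f F n.+1).
rewrite /sqint /= ge0_integral_pushforward//; last 2 first.
- exact: measurable_tcons.
- by move=> t _; rewrite lee_fin sqnorm_ge0.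
rewrite preimage_setT.
have mfF : measurable_fun [set: RR * n.-tuple RR]
    (fun x => (sqnorm (f x.1))%:E * (sqnorm (F n x.2))%:E)%E.
  apply: emeasurable_funM.
    exact: (measurableT_comp mf measurable_fst).
  exact: (measurableT_comp mF measurable_snd).
apply: (@le_trans _ _ (\int[mu_half \x mu_tuple n]_x
    (wmax%:E * ((sqnorm (f x.1))%:E * (sqnorm (F n x.2))%:E)))%E).
  apply: ge0_le_integral => //.
  - by move=> x _; rewrite lee_fin sqnorm_ge0.
  - exact: (measurableT_comp mc (@measurable_tcons n)).
  - by apply: measurable_funeM.
  move=> [x t] _; change ((sqnorm (creation_fun f F (tcons (x, t))))%:E
    <= wmax%:E * ((sqnorm (f x))%:E * (sqnorm (F n t))%:E))%E.
  have -> : creation_fun f F (tcons (x, t)) =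
      f x * (sqrt_w (tcons (x, t)))%:C * F n t.
    rewrite /creation_fun theadE; congr (_ * F n _); exact/val_inj.
  rewrite -!EFinM lee_fin !sqnormM mulrAC mulrC.
  rewrite ler_wpM2r ?mulr_ge0 ?sqnorm_ge0//.
  by rewrite sqnormC sqr_sqrt_w_le.
rewrite ge0_integralZl_EFin//; last by move=> x _; rewrite mule_ge0 ?pos.
rewrite -muleA lee_wpmul2l ?lee_fin//.
rewrite fubini_tonelli1//; last by move=> x; rewrite mule_ge0 ?pos.
rewrite /fubini_F/= (eq_integral (fun x => (sqnorm (f x))%:E *
    \int[mu_tuple n]_y (sqnorm (F n y))%:E)%E); last first.
  move=> x _; rewrite ge0_integralZl_EFin ?sqnorm_ge0//.
  by move=> y _; rewrite lee_fin sqnorm_ge0.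
rewrite ge0_integralZr//; first by move=> y _; rewrite lee_fin sqnorm_ge0.
by apply: integral_ge0 => y _; rewrite lee_fin sqnorm_ge0.
Qed.

Lemma creation_finite (f : L2) (F : fock_fun) :
  (\sum_(0 <= n <oo) sqint (mu_tuple n) (creation_fun f F (n := n)) < +oo)%E.
Proof.
rewrite nneseries_recl//; last by move=> n _; exact: sqint_ge0.
rewrite sqint0 add0e -nneseries_addn; last by move=> n; exact: sqint_ge0.
under eq_eseriesr do rewrite addn1.
have M0 : 0 <= wmax by rewrite !addr_ge0.
have f0 : (0 <= sqint mu_half f)%E by exact: sqint_ge0.
have fF : (sqint mu_half f \is a fin_num)%E.
  by rewrite ge0_fin_numE// L2_finite.
apply: le_lt_trans.
  apply: lee_nneseries => [n _ _|n _]; first exact: sqint_ge0.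
  exact: sqint_creation.
rewrite /= -(fineK fF) -EFinM nneseriesZl//; last first.
  by move=> n _; exact: sqint_ge0.
by rewrite lte_mul_pinfty ?lee_fin ?mulr_ge0 ?fine_ge0// fock_finite.
Qed.

(* The class obtained depends only on the classes of f and F. *)
Definition creation (f : L2) (F : fock) : fock :=
  \pi_fock (MkFockFun (measurable_creation f (repr F)) (creation_finite f (repr F))).

Definition is_adjoint (T S : fock -> fock) : Prop :=
  forall F G, inner (T F) G = inner F (S G).

(* There is at most one S with is_adjoint T S since inner is definite on fock,
   and there is one if T is a bounded linear operator, as creation f is. The
   default value is used only for operators without an adjoint. *)
Definition adjoint (T : fock -> fock) : fock -> fock :=
  xget (fun=> vacuum) [set S | is_adjoint T S].

Definition omega (f : L2) (F : fock) : fock :=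
  fock_add (creation f F) (adjoint (creation f) F).

Definition vacuum_state (T : fock -> fock) : R[i] := inner (T vacuum) vacuum.

End fock_space.

(* Main.v *)
Require Import Defs.
From mathcomp Require Import all_boot all_order all_algebra.
From mathcomp Require Import zify.
Set Implicit Arguments.
Unset Strict Implicit.
Unset Printing Implicit Defensive.
Import Order.TTheory GRing.Theory Num.Theory.

(** Read the word [omega f_1 ... omega f_n] applied to the vacuum as the history of
a stack.  A vector of the Fock space is a function of a list of variables; a
creation operator adds a variable at the front of the list and an annihilation
operator integrates the front variable out.  The integral operator shows
that creation has an adjoint ([creation_adjoint]), and two adjoints agree when
tested against vectors; so the vector obtained from a word can be computed
explicitly up to such tests ([word_weak_eq]), and the vacuum expectation is its
value at the empty list.  Every vector that occurs is the product of [sqrt (w (t_i, t_i+1))]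
  along
the list times a function in which only whole powers of [w] are left
([wordF_value]).  That function is [moment]: reading the word from left to
right, a letter [f] either opens a variable [s] above the current top [t] of
the stack, at the cost of integrating against [f s * w s t], or closes the top
variable [s], at the cost of a factor [f s].

The variables are the blocks of a pair partition, the stack discipline says
that the partition is non-crossing, and the top of the stack at the moment when
a block opens is the block that covers it.  The integrand depends on the
variables only through their relative order and through the intervals in which
they lie.  Therefore, whenever a variable is opened, its integral is split
according to its place among the variables opened before ([iter_int_split]);
on each piece [w s t] is the constant [p] or [q].  The result is a sum over all
histories of a stack whose blocks carry a linear order ([expansion]).  Such
histories are exactly the ordered non-crossing pairings ([states_valid],
[sum_ONC2]), and the constants multiply to the weight ([weight_chords]).

What is left for one ordered pairing is the volume of the set of increasing
lists whose [i]-th entry lies in a prescribed interval [J_i].  It vanishes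
unless the [J_i] are weakly increasing, that is, unless the pairing is adapted
([simplex_vol_unsorted], [adapted_chords]).  If they are, adding one more
variable in the interval [I_c] and splitting as before shows that [lambda I_c]
times the old volume is the number of equal new boxes times the new volume;
this gives [lambda ^ b / b!] for each interval ([simplex_vol_sorted]). *)

(** * Histories of a stack with an order on its blocks *)

Definition ins (T : Type) j (x : T) s := take j s ++ x :: drop j s.

Lemma perm_ins (T : eqType) j (x : T) s : perm_eq (ins j x s) (x :: s).
Proof.
rewrite /ins -{3}(cat_take_drop j s) -cat1s perm_catCA.
by rewrite perm_refl.
Qed.

Lemma size_ins (T : Type) j (x : T) s : size (ins j x s) = (size s).+1.
Proof. by rewrite /ins size_cat /= addnS -size_cat cat_take_drop. Qed.

Lemma ins_rem (T : eqType) (x : T) s : x \in s -> ins (index x s) x (rem x s) = s.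
Proof.
move=> xs; have si : size (take (index x s) s) = index x s.
  by rewrite size_takel// index_size.
rewrite remE /ins take_size_cat// drop_size_cat//.
by rewrite -drop_index// cat_take_drop.
Qed.

(** The left inverse [g] makes the lists [f x] pairwise disjoint. *)
Lemma uniq_flatten_map (T U : eqType) (f : T -> seq U) (g : U -> T) s :
  uniq s -> {in s, forall x, uniq (f x)} ->
  (forall x y, x \in s -> y \in f x -> g y = x) ->
  uniq (flatten [seq f x | x <- s]).
Proof.
elim: s => [//|x s IH] /= /andP[xs us] uf gK.
rewrite cat_uniq uf ?mem_head//= IH//; first last.
- by move=> z y zs; apply: gK; rewrite inE zs orbT.
- by move=> z zs; apply: uf; rewrite inE zs orbT.
rewrite andbT; apply/hasPn => y /flatten_mapP[z zs yz]; apply/negP => yx.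
move: xs; rewrite -(gK x y) ?mem_head//.
by rewrite (gK z y) ?zs// inE zs orbT.
Qed.

Section states.
Variable n : nat.
Implicit Types (B C D : nat * nat) (L : seq (nat * nat)).

(** A block is a pair of an opening and a closing time, and the closing time [n]
marks a block that is still open.  With this convention an open block encloses
everything opened after it, and closing it at time [k] does not change what it
encloses among the blocks opened before [k]. *)
Definition encloses B C := (B.1 < C.1) && (C.1 < B.2).

(** The covering relation of [encloses] inside [L]. *)
Definition parent L B C := encloses B C && ~~ has (fun D => encloses B D && encloses D C) L.

Definition close_block a k B := if B.1 == a then (a, k) else B.
Definition open_stack k L := [seq a <- rev (iota 0 k) | (a, n) \in L].
Definition succ_states k L :=
  [seq ins j (k, n) L | j <- iota 0 (size L).+1] ++
  (if open_stack k L is a :: _ then [:: map (close_block a k) L] else [::]).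
Fixpoint states k :=
  if k is k'.+1 then flatten [seq succ_states k' L | L <- states k'] else [:: [::]].

Definition endpoints L := map fst L ++ [seq b <- map snd L | b < n].

Definition crossing B C := [&& B.1 < C.1, C.1 < B.2 & B.2 < C.2].

(** The static description of the states reached after [k] steps.  Taking [C] open
in the crossing condition also forbids an open block inside a closed one, which
is what makes the top of the stack the only block that may be closed. *)
Definition valid k L :=
  [&& all (fun B => (B.1 < k) && ((B.2 == n) || (B.1 < B.2 < k))) L,
      perm_eq (endpoints L) (iota 0 k) &
      all (fun B => all (fun C => ~~ crossing B C) L) L].

Lemma perm_valid k L L' : perm_eq L L' -> valid k L = valid k L'.
Proof.
move=> LL'; rewrite /valid (perm_all _ LL').
have -> : perm_eq (endpoints L) (iota 0 k) = perm_eq (endpoints L') (iota 0 k).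
  apply: permPl; apply: perm_cat; first exact: perm_map.
  by apply: perm_filter; exact: perm_map.
rewrite (perm_all _ LL'); congr [&& _, _ & _].
by apply: eq_all => B; exact: perm_all.
Qed.

Lemma perm_iotaS k : perm_eq (iota 0 k.+1) (k :: iota 0 k).
Proof. by rewrite -addn1 iotaD cats1 perm_rcons. Qed.

Lemma valid_open k L : k < n -> valid k L -> valid k.+1 ((k, n) :: L).
Proof.
move=> kn /and3P[/allP b e c]; apply/and3P; split.
- apply/allP => B; rewrite inE => /predU1P[->/=|/b]; first by rewrite ltnSn eqxx.
  by case/andP=> ? /orP[/eqP->|]; lia.
- rewrite /endpoints/= ltnn.
  by rewrite (permPr (perm_iotaS k)) perm_cons.
- have cr B C : B \in L -> C \in L -> ~~ crossing B C.
    by move=> BL CL; move/allP : c => /(_ _ BL)/allP; exact.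
  apply/allP => B BL; apply/allP => C CL; move: BL CL; rewrite !inE /crossing.
  move=> /predU1P[->|BL] /predU1P[->|CL] /=; last exact: cr.
  + lia.
  + move/b : CL; lia.
  + move/b : BL; lia.
Qed.

(** Closing any block other than the latest open one would leave an open block
inside a closed one. *)
Lemma valid_close k a L : k < n ->
  (forall a', (a', n) \in L -> a' < a) ->
  valid k ((a, n) :: L) -> valid k.+1 ((a, k) :: L).
Proof.
move=> kn top /and3P[/=/andP[/andP[ak _] /allP b] e c]; apply/and3P; split.
- apply/allP => B; rewrite inE => /predU1P[->/=|/b]; first lia.
  by case/andP=> ? /orP[/eqP->|]; lia.
- move: e; rewrite /endpoints/= ltnn kn => e.
  rewrite (permPr (perm_iotaS k)).
  rewrite -cat_cons -(cat1s k) perm_catCA /= perm_cons.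
  exact: e.
- move: c => /andP[/andP[_ ca] c].
  have cr B C : B \in L -> C \in L -> ~~ crossing B C.
    by move=> BL CL; move/allP : c => /(_ _ BL)/andP[_ /allP]; exact.
  apply/allP => B BL; apply/allP => C CL; move: BL CL; rewrite !inE /crossing.
  move=> /predU1P[->|BL] /predU1P[->|CL] /=; last exact: cr.
  + lia.
  + case: C CL => c1 c2 CL /=; move: (b _ CL) (top c1) => /=.
    case: (c2 =P n) CL => [->|] CL; last lia.
    move=> _ /(_ CL); lia.
  + case: B BL => c1 c2 CL /=; move: (b _ CL) => /=.
    move/allP : c => /(_ _ CL) /andP[]; rewrite /crossing/=; lia.
Qed.

Lemma valid_unopen k L : k < n -> valid k.+1 ((k, n) :: L) -> valid k L.
Proof.
move=> kn /and3P[b e c].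
have e' : perm_eq (endpoints L) (iota 0 k).
  by move: e; rewrite /endpoints/= ltnn (permPr (perm_iotaS k)) perm_cons.
have lt x : (x \in endpoints L) -> x < k.
  by rewrite (perm_mem e') mem_iota.
apply/and3P; split => //.
  move/andP : b => [_ /allP b]; apply/allP => -[x y] BL; have /= := b _ BL.
  have /lt : x \in endpoints L by rewrite mem_cat (map_f fst BL).
  have : (y < n) -> y \in endpoints L.
    by move=> yn; rewrite mem_cat mem_filter yn (map_f snd BL) orbT.
  move=> ylt -> /andP[_ /orP[->//|/andP[xy yk]]]; rewrite xy.
  by rewrite (lt y) ?orbT//; apply: ylt; lia.
by apply/allP => B BL; move/andP : c => [_ /allP/(_ _ BL)/andP[]].
Qed.

(** Conversely, the block closed last was on top: an open block above it would
cross it. *)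
Lemma valid_unclose k a L : k < n ->
  valid k.+1 ((a, k) :: L) ->
  valid k ((a, n) :: L) /\ (forall a', (a', n) \in L -> a' < a).
Proof.
move=> kn /and3P[b e c].
have e' : perm_eq (endpoints ((a, n) :: L)) (iota 0 k).
  move: e; rewrite /endpoints/= kn ltnn (permPr (perm_iotaS k)).
  by rewrite -cat_cons -(cat1s k) perm_catCA /= perm_cons.
have lt x : (x \in endpoints ((a, n) :: L)) -> x < k.
  by rewrite (perm_mem e') mem_iota.
have u := perm_uniq e'; rewrite iota_uniq in u.
have top a' : (a', n) \in L -> a' < a.
  move=> a'L; move/andP: c => [/andP[_ /allP/(_ _ a'L)]].
  rewrite /crossing/= kn.
  have /lt a'k : a' \in endpoints ((a, n) :: L).
    by rewrite mem_cat (map_f fst (x:=(a',n))) ?inE ?a'L ?orbT.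
  rewrite a'k !andbT -leqNgt leq_eqVlt => /predU1P[aa'|->//].
  move: u; rewrite /endpoints/= mem_cat negb_or => /andP[/andP[]].
  by rewrite -aa' (map_f fst a'L).
split => //; apply/and3P; split => //.
  move/andP : b => [/andP[ak1 _]/allP b]; apply/andP; split.
    by rewrite /= eqxx andbT; apply: lt; rewrite /endpoints/= inE eqxx.
  apply/allP => -[x y] BL; have /= := b _ BL.
  have /lt : x \in endpoints ((a, n) :: L).
    by rewrite mem_cat (map_f fst (x:=(x,y))) ?inE ?BL ?orbT.
  have : (y < n) -> y \in endpoints ((a, n) :: L).
    move=> yn; rewrite mem_cat mem_filter yn (map_f snd (x:=(x,y))) ?orbT//.
    by rewrite inE BL orbT.
  move=> ylt -> /andP[_ /orP[->//|/andP[xy yk]]]; rewrite xy.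
  by rewrite (lt y) ?orbT//; apply: ylt; lia.
have cr B C : B \in L -> C \in L -> ~~ crossing B C.
  by move=> BL CL; move/andP : c => [_ /allP /(_ _ BL)/andP[_ /allP]]; exact.
have lt2 x y : (x, y) \in L -> x < k /\ (y <= n).
  move=> BL; split.
    by apply: lt; rewrite mem_cat (map_f fst (x:=(x,y))) ?inE ?BL ?orbT.
  by move/andP : b => [_ /allP/(_ _ BL)] /=; lia.
apply/allP => B BL; apply/allP => C CL; move: BL CL; rewrite !inE /crossing.
move=> /predU1P[->|BL] /predU1P[->|CL] /=; last exact: cr.
+ lia.
+ case: C CL => c1 c2 /lt2 /=; lia.
+ case: B BL => c1 c2 BL /=; have := lt2 _ _ BL.
  move/andP: c => [_ /allP/(_ _ BL)/andP[]]; rewrite /crossing /= => H _ H2.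
  have : (c2 < n) -> c2 < k.
    move=> yn; apply: lt.
    rewrite mem_cat mem_filter yn (map_f snd (x:=(c1,c2))) ?orbT//.
    by rewrite inE BL orbT.
  lia.
Qed.

Lemma valid_uniq k L : valid k L ->
  [/\ uniq L, uniq (map fst L) & uniq [seq b <- map snd L | b < n]].
Proof.
move=> /and3P[_ e _]; have := perm_uniq e.
rewrite iota_uniq cat_uniq => /and3P[u _ u']; split => //.
exact: map_uniq u.
Qed.

Lemma open_stack_top k L a s : valid k L -> open_stack k L = a :: s ->
  [/\ (a, n) \in L, a < k & forall a', (a', n) \in L -> a' <= a].
Proof.
move=> vL oL.
have : a \in open_stack k L by rewrite oL mem_head.
rewrite mem_filter mem_rev mem_iota => /and3P[aL _ ak]; split => // a' a'L.
have a'k : a' < k by move/and3P : vL => [/allP/(_ _ a'L)/andP[]].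
have : a' \in open_stack k L by rewrite mem_filter mem_rev mem_iota a'L.
have : sorted (fun x y => y < x) (open_stack k L).
  apply: sorted_filter; first by move=> x y z /[swap]; exact: ltn_trans.
  by rewrite rev_sorted iota_ltn_sorted.
rewrite oL /= (path_sortedE); last by move=> x y z /[swap]; exact: ltn_trans.
by move=> /andP[/allP as_ _]; rewrite inE => /predU1P[->//|/as_ /ltnW].
Qed.

Lemma open_stack_consE k L a : (a, n) \in L -> a < k ->
  (forall a', (a', n) \in L -> a' <= a) -> valid k L ->
  exists s, open_stack k L = a :: s.
Proof.
move=> aL ak top vL; case oL : (open_stack k L) => [|b s].
  have : a \in open_stack k L by rewrite mem_filter mem_rev mem_iota aL.
  by rewrite oL.
exists s; congr cons; have [bL bk bt] := open_stack_top vL oL.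
by apply/eqP; rewrite eqn_leq top// bt.
Qed.

Lemma perm_block k a b L : valid k L -> (a, b) \in L ->
  exists2 L1, perm_eq L ((a, b) :: L1) & all (fun B => B.1 != a) L1.
Proof.
move=> vL aL; exists (rem (a, b) L); first exact: perm_to_rem.
have [_ u _] := valid_uniq vL.
move: (perm_uniq (perm_map fst (perm_to_rem aL))); rewrite u /= => /esym/andP[nu _].
by apply/allP => -[x y] B; apply: contra nu => /eqP/= xa; move: (map_f fst B); rewrite /= xa.
Qed.

Lemma map_close_id k a L1 : all (fun B => B.1 != a) L1 -> map (close_block a k) L1 = L1.
Proof.
move=> /allP nu; rewrite -[RHS]map_id; apply/eq_in_map => B /nu.
by rewrite /close_block => /negPf ->.
Qed.

Lemma valid_succ k L L' : k < n -> valid k L -> L' \in succ_states k L -> valid k.+1 L'.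
Proof.
move=> kn vL; rewrite mem_cat => /orP[/mapP[j _ ->]|].
  by rewrite (perm_valid _ (perm_ins _ _ _)); exact: valid_open.
case oL : open_stack => [//|a s]; rewrite inE => /eqP ->.
have [aL ak top] := open_stack_top vL oL.
have [L1 LL1 nL1] := perm_block vL aL.
rewrite (perm_valid _ (perm_map (close_block a k) LL1)) /= map_close_id// {1}/close_block eqxx.
rewrite (perm_valid _ LL1) in vL.
apply: valid_close => // a' a'L1; rewrite ltn_neqAle top ?andbT; last first.
  by rewrite (perm_mem LL1) inE a'L1 orbT.
by move/allP : nL1 => /(_ _ a'L1).
Qed.

Lemma valid_pred k L' : k < n -> valid k.+1 L' ->
  exists2 L, valid k L & L' \in succ_states k L.
Proof.
move=> kn vL'; have /and3P[b e _] := vL'.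
have : k \in endpoints L' by rewrite (perm_mem e) mem_iota leq0n ltnSn.
rewrite mem_cat mem_filter => /orP[/mapP[[k0 y] kL'/= k0E]|].
  subst k0; have yn : y = n.
    by move/allP : b => /(_ _ kL')/=; lia.
  subst y.
  exists (rem (k, n) L').
    by apply: valid_unopen => //; rewrite -(perm_valid _ (perm_to_rem kL')).
  rewrite mem_cat; apply/orP; left; apply/mapP; exists (index (k, n) L').
    rewrite mem_iota add0n size_rem// prednK; last by case: (L') kL'.
    by rewrite leq0n /= index_mem.
  by rewrite ins_rem.
move=> /andP[_ /mapP[[a k0] aL' /= k0E]]; subst k0.
have [L1 L'L1 nL1] := perm_block vL' aL'.
have := vL'; rewrite (perm_valid _ L'L1) => /(valid_unclose kn)[vL top].
(* Closing at time [n] reopens the block of [a]. *)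
have perL : perm_eq (map (close_block a n) L') ((a, n) :: L1).
  rewrite (permPl (perm_map _ L'L1)) /= map_close_id//.
  by rewrite /close_block /= eqxx.
exists (map (close_block a n) L'); first by rewrite (perm_valid _ perL).
have [||||s oL] := @open_stack_consE k (map (close_block a n) L') a.
- by rewrite (perm_mem perL) mem_head.
- by move/and3P : vL => [/andP[/= /andP[]]].
- move=> a'; rewrite (perm_mem perL) inE => /predU1P[[->]//|/top].
  exact: ltnW.
- by rewrite (perm_valid _ perL).
rewrite mem_cat oL; apply/orP; right; rewrite inE; apply/eqP.
rewrite -map_comp; apply/esym; rewrite -[RHS]map_id; apply/eq_in_map => B.
rewrite (perm_mem L'L1) inE /close_block => /predU1P[->|/(allP nL1)/=].
  by rewrite /= eqxx /= eqxx.
by move=> /negPf Ba; rewrite Ba /= Ba.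
Qed.

(** Every valid state is reached, because its last event can be undone. *)
Lemma states_valid k L : k <= n -> (L \in states k) = valid k L.
Proof.
elim: k L => [|k IH] L kn.
  rewrite /= inE; apply/eqP/idP => [->//|/and3P[_ /perm_size]].
  by rewrite size_cat size_map; case: L.
have kn' := ltnW kn.
apply/flatten_mapP/idP => [[L0]|]; first by rewrite IH//; exact: valid_succ.
by move=> /(valid_pred kn)[L0 v0 ?]; exists L0; rewrite ?IH.
Qed.

(** Forgetting the events from time [k] on; this recovers the predecessor of a
state and so shows that histories are determined by where they end. *)
Definition restr k L := [seq (B.1, if B.2 < k then B.2 else n) | B <- L & B.1 < k].

Lemma restr_id k L : valid k L -> k <= n -> restr k L = L.
Proof.
move=> /and3P[/allP b _ _] kn; rewrite /restr.
rewrite (_ : [seq _ <- L | _] = L); last first.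
  by apply/all_filterP/allP => B /b /andP[].
rewrite -[RHS]map_id; apply/eq_in_map => -[x y] /b /= /andP[_ /orP[/eqP->|]].
  by rewrite ltnNge kn.
by move=> /andP[_ ->].
Qed.

Lemma restr_succ k L L' : k < n -> valid k L -> L' \in succ_states k L ->
  restr k L' = L.
Proof.
move=> kn vL; rewrite mem_cat => /orP[/mapP[j _ ->]|].
  rewrite /restr /ins filter_cat/= ltnn -filter_cat cat_take_drop.
  exact: (restr_id vL (ltnW kn)).
case oL : open_stack => [//|a s]; rewrite inE => /eqP ->.
have [aL ak top] := open_stack_top vL oL.
rewrite -[RHS](restr_id vL (ltnW kn)) /restr filter_map -map_comp.
have [L1 LL1 nL1] := perm_block vL aL.
rewrite (_ : [seq _ <- L | _] = [seq B <- L | B.1 < k]); last first.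
  by apply: eq_filter => B /=; rewrite /close_block; case: eqP => [->|].
apply/eq_in_map => B; rewrite mem_filter => /andP[_].
rewrite (perm_mem LL1) inE /close_block => /predU1P[->|/(allP nL1)/= /negPf->//].
by rewrite /= eqxx /= ltnn ltnNge (ltnW kn).
Qed.

Lemma ins_inj (T : eqType) (x : T) s j j' : x \notin s -> j <= size s ->
  j' <= size s -> ins j x s = ins j' x s -> j = j'.
Proof.
move=> xs.
have ix i : i <= size s -> index x (ins i x s) = i.
  move=> ls; rewrite /ins index_cat ifF /= ?eqxx ?addn0 ?size_takel//.
  by apply/negP => /mem_take; apply/negP.
by move=> /ix {2}<- /ix {2}<- ->.
Qed.

Lemma uniq_succ k L : k < n -> valid k L -> uniq (succ_states k L).
Proof.
move=> kn vL; have kL b : (k, b) \notin L.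
  by apply/negP => kL; move/and3P : vL => [/allP/(_ _ kL)]; rewrite /= ltnn.
rewrite cat_uniq; apply/and3P; split.
- rewrite map_inj_in_uniq ?iota_uniq// => j j'; rewrite !mem_iota !add0n !ltnS.
  by move=> /andP[_ +] /andP[_]; exact: ins_inj.
- case oL : open_stack => [//|a s]; rewrite has_seq1; apply/negP => /mapP[j _ /(congr1 size)].
  by rewrite size_map size_ins => /n_Sn.
- by case: open_stack.
Qed.

Lemma uniq_states k : k <= n -> uniq (states k).
Proof.
elim: k => [//|k IH] kn.
have sv L : L \in states k -> valid k L by rewrite states_valid// ltnW.
apply: (uniq_flatten_map (g := restr k)) => [|L /sv|L L' /sv].
- exact: IH (ltnW kn).
- exact: uniq_succ.
- exact: restr_succ.
Qed.

End states.

Section insertion_weight.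
Variables (n : nat) (R : comNzRingType) (p q : R).
Implicit Types (B C D : nat * nat) (L : seq (nat * nat)).

(** The weight of a state, defined without reference to its history.  A product
over pairs of blocks is easier to follow through insertions than two counters. *)
Definition partial_weight L : R :=
  (\prod_(C <- L) \prod_(B <- L | parent L B C)
     (if (index C L < index B L)%N then p else q))%R.

(** Factor gained by inserting a block at place [j]: only the pair formed with its
parent, the top of the stack, is new. *)
Definition open_weight k L j : R :=
  if open_stack n k L is a :: _ then
    if j <= index (a, n) L then p else q
  else 1%R.

Lemma index_ins (T : eqType) j (x y : T) s : x != y -> j <= size s ->
  index y (ins j x s) = if index y s < j then index y s else (index y s).+1.
Proof.
move=> /negPf xy js; rewrite /ins index_cat /= xy.
have E := cat_take_drop j s.
have sj : size (take j s) = j by rewrite size_takel.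
rewrite -[in index y s]E index_cat sj; case: ifP => yt.
  by have := yt; rewrite -index_mem sj => ->.
by rewrite ltnNge leq_addr /= addnS.
Qed.

Lemma index_ins_lt (T : eqType) j (x y z : T) s : x != y -> x != z -> j <= size s ->
  (index y (ins j x s) < index z (ins j x s)) = (index y s < index z s).
Proof. move=> xy xz js; rewrite !index_ins//; move: (index y s) (index z s) => a b.
by case: (ltnP a j) => ?; case: (ltnP b j) => ?; lia. Qed.

Lemma index_ins_new (T : eqType) j (x : T) s : x \notin s -> j <= size s ->
  index x (ins j x s) = j.
Proof.
move=> xs js; rewrite /ins index_cat ifF /= ?eqxx ?addn0 ?size_takel//.
by apply/negP => /mem_take; apply/negP.
Qed.

Lemma valid_lt k L B : valid n k L -> B \in L -> B.1 < k.
Proof. by move=> /and3P[/allP b _ _] /b /andP[]. Qed.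

Lemma encloses_lt k L C : valid n k L -> C \in L -> encloses (k, n) C = false.
Proof.
by move=> v /(valid_lt v) Ck; rewrite /encloses /=; apply/negP => /andP[]; lia.
Qed.

(** A block that has just been opened encloses nothing, so the parents of the old
blocks do not change, nor does their relative order. *)
Lemma partial_weight_ins k L j : k < n -> valid n k L -> j <= size L ->
  partial_weight (ins j (k, n) L) = (partial_weight L * open_weight k L j)%R.
Proof.
move=> kn vL js; set L' := ins _ _ _.
have pL' : perm_eq L' ((k, n) :: L) by exact: perm_ins.
have hasE P : has P L' = P (k, n) || has P L by rewrite (perm_has _ pL').
have parO B C : C \in L -> parent L' B C = parent L B C.
  by move=> CL; rewrite /parent hasE (encloses_lt vL CL) andbF.
have kL B : B \in L -> (k, n) != B.
  by move=> BL; apply/eqP => E; have := valid_lt vL BL; rewrite -E ltnn.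
have [uL _ _] := valid_uniq vL.
rewrite /partial_weight (perm_big _ pL') big_cons [RHS]mulrC; congr (_ * _)%R; last first.
  apply: eq_big_seq => C CL.
  rewrite (perm_big _ pL') big_cons parO// {1}/parent (encloses_lt vL CL) /=.
  rewrite big_seq_cond [RHS]big_seq_cond.
  apply: eq_big => [B|B /andP[BL _]]; first by case BL : (B \in L) => //=; rewrite parO.
  by rewrite index_ins_lt// kL.
have openP B : B \in L -> encloses B (k, n) = (B.2 == n).
  move=> BL; rewrite /encloses /= (valid_lt vL BL) /=.
  by move/and3P : vL => [/allP/(_ _ BL) /= + _ _]; lia.
have nkk : encloses (k, n) (k, n) = false by rewrite /encloses ltnn.
rewrite (perm_big _ pL') big_cons {1}/parent nkk /=.
rewrite /open_weight; case oL : open_stack => [|a s].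
  rewrite big_seq_cond big1// => B /andP[BL]; rewrite /parent openP//.
  move=> /andP[/eqP B2 _].
  have : B.1 \in open_stack n k L.
    rewrite mem_filter mem_rev mem_iota leq0n add0n (valid_lt vL BL) -[X in (_, X)]B2.
    by rewrite -surjective_pairing BL.
  by rewrite oL.
have [aL ak top] := open_stack_top vL oL.
have pa : parent L' (a, n) (k, n).
  rewrite /parent openP// eqxx hasE /= nkk andbF /=; apply/hasPn => -[x y] BL.
  rewrite openP//=; apply/negP => /andP[+ /eqP yn]; subst y.
  by rewrite /encloses/=; have := top x BL; lia.
rewrite big_mkcond (bigD1_seq (a, n))//= pa [X in (_ * X)%R]big1_seq ?mulr1.
  rewrite index_ins_new ?index_ins//; last 2 first.
  - exact: kL.
  - by apply/negP => /kL; rewrite eqxx.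
  case: (ltnP (index (a, n) L) j) => h; last by rewrite ltnS h.
  by rewrite ltnNge (ltnW h).
move=> [x y] /andP[Ba BL]; case: ifP => //.
rewrite /parent openP//= => /andP[/eqP yn /hasPn]; subst y.
move=> /(_ (a, n)); rewrite (perm_mem pL') inE aL orbT => /(_ isT).
rewrite openP// eqxx andbT /encloses /= (leq_trans ak (ltnW kn)) andbT -leqNgt => ax.
by case/negP: Ba; apply/eqP; congr pair; apply/eqP; rewrite eqn_leq ax top.
Qed.

Lemma index_map_in (T U : eqType) (f : T -> U) s x :
  {in s &, injective f} -> x \in s -> index (f x) (map f s) = index x s.
Proof.
elim: s => [//|y s IH] fI xs /=; rewrite inE in xs.
case: (eqVneq y x) xs fI => [-> _ _|yx xs fI]; first by rewrite eqxx.
rewrite /= in xs.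
have -> : (f y == f x) = false.
  by apply/eqP => /fI E; move: yx; rewrite E ?eqxx ?inE ?xs ?eqxx ?orbT.
by rewrite IH// => z t zs ts; apply: fI; rewrite inE ?zs ?ts orbT.
Qed.

Lemma close_inj k L a : valid n k L -> (a, n) \in L -> {in L &, injective (close_block a k)}.
Proof.
move=> vL aL; have [L1 LL1 nL1] := perm_block vL aL.
  move=> B C; rewrite !(perm_mem LL1) !inE /close_block.
  move=> /predU1P[->|BL] /predU1P[->|CL]//=; rewrite ?eqxx.
  - by rewrite (negPf (allP nL1 _ CL)) => E; have := allP nL1 _ CL; rewrite -E/= eqxx.
  - by rewrite (negPf (allP nL1 _ BL)) => E; have := allP nL1 _ BL; rewrite E/= eqxx.
  - by rewrite (negPf (allP nL1 _ CL)) (negPf (allP nL1 _ BL)).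
Qed.

(** All opening times are smaller than [k], so that replacing the closing time [n]
by [k] changes no enclosure. *)
Lemma partial_weight_close k L a s : k < n -> valid n k L -> open_stack n k L = a :: s ->
  partial_weight (map (close_block a k) L) = partial_weight L.
Proof.
move=> kn vL oL; have [aL ak top] := open_stack_top vL oL.
have [L1 LL1 nL1] := perm_block vL aL.
have cinj := close_inj vL aL.
have enc B C : B \in L -> C \in L -> encloses (close_block a k B) (close_block a k C) =
  encloses B C.
  move=> BL CL; have c1 D : (close_block a k D).1 = D.1.
    by rewrite /close_block; case: eqP => [->|].
  rewrite /encloses !c1; case: (B.1 < C.1) => //=.
  move: BL; rewrite (perm_mem LL1) inE /close_block => /predU1P[->/=|BL].
    by rewrite eqxx /= (valid_lt vL CL); have := valid_lt vL CL; lia.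
  by rewrite (negPf (allP nL1 _ BL)).
have par B C : B \in L -> C \in L ->
    parent (map (close_block a k) L) (close_block a k B) (close_block a k C) = parent L B C.
  move=> BL CL; rewrite /parent enc// has_map; congr (_ && ~~ _).
  by apply: eq_in_has => D DL /=; rewrite !enc.
rewrite /partial_weight big_map; apply: eq_big_seq => C CL.
rewrite big_map big_seq_cond [RHS]big_seq_cond.
have idx : {in L, forall B, index (close_block a k B) (map (close_block a k) L) = index B L}.
  move=> B BL; exact: (index_map_in cinj).
apply: eq_big => [B|B /andP[BL _]]; first by case BL : (B \in L) => //=; rewrite par.
by rewrite !idx.
Qed.
End insertion_weight.

(** * Histories and ordered non-crossing pairings *)

Section pairings.
Variable n : nat.
Implicit Types (B C D : nat * nat) (L : seq (nat * nat)).

Definition chord_set B : {set 'I_n} := [set i : 'I_n | (i == B.1 :> nat) || (i == B.2 :> nat)].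
Definition chord B := (B.1 < B.2 < n).

Lemma in_chord_set B (i : 'I_n) : (i \in chord_set B) = (i == B.1 :> nat) || (i == B.2 :> nat).
Proof. by rewrite inE. Qed.

Lemma chord_setE B : chord B -> exists i j : 'I_n,
  [/\ i = B.1 :> nat, j = B.2 :> nat & chord_set B = [set i; j]].
Proof.
case: B => a b /= /andP[/= ab bn].
exists (Ordinal (ltn_trans ab bn)), (Ordinal bn); split => //.
by apply/setP => k; rewrite !inE.
Qed.

Lemma card_chord_set B : chord B -> #|chord_set B| = 2.
Proof.
move=> cB; have [i [j [iB jB ->]]] := chord_setE cB; rewrite cards2.
by move: cB => /andP[]; rewrite -iB -jB; case: eqP => [->|]//; rewrite ltnn.
Qed.

Lemma chord_set_inj B C : chord B -> chord C -> chord_set B = chord_set C -> B = C.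
Proof.
move=> cB cC E; have [i [j [iB jB EB]]] := chord_setE cB.
have [i' [j' [iC jC EC]]] := chord_setE cC.
have : (i \in chord_set C) && (j \in chord_set C) by rewrite -E EB !inE !eqxx orbT.
have : (i' \in chord_set B) && (j' \in chord_set B) by rewrite E EC !inE !eqxx orbT.
rewrite !in_chord_set iB jB iC jC; move: cB cC.
case: B C {E iB jB EB iC jC EC} => [a b] [c d]; rewrite /chord /= => ? ? ? ?.
by congr pair; lia.
Qed.

Lemma chord_of_pair (A : {set 'I_n}) : #|A| = 2 -> exists2 B, chord B & A = chord_set B.
Proof.
move/eqP => /cards2P[x [y [xy ->]]].
wlog lt : x y xy / x < y.
  move=> W; have [|yx|/val_inj E] := ltngtP x y; first exact: W.
  - by rewrite setUC; apply: W; rewrite // eq_sym.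
  - by rewrite E eqxx in xy.
exists (val x, val y); first by rewrite /chord /= lt /=.
by apply/setP => k; rewrite in_chord_set !inE.
Qed.

Lemma chords_of_pairs (P : seq {set 'I_n}) : all (fun A : {set 'I_n} => #|A| == 2) P ->
  exists2 L, all chord L & P = map chord_set L.
Proof.
elim: P => [_|A P IH /= /andP[/eqP/chord_of_pair[B cB ->] /IH[L cL ->]]]; first by exists [::].
by exists (B :: L); rewrite //= cB.
Qed.

Section chords.
Variable L : seq (nat * nat).
Hypothesis cL : all chord L.

Lemma chord_set_inj_in : {in L &, injective chord_set}.
Proof. by move=> B C BL CL; apply: chord_set_inj; exact: (allP cL). Qed.

Lemma endpoints_chords : endpoints n L = map fst L ++ map snd L.
Proof.
rewrite /endpoints; congr cat; apply/all_filterP/allP => x /mapP[B BL ->].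
by have /andP[] := allP cL _ BL.
Qed.

Lemma mem_endpoints (x : 'I_n) :
  (val x \in endpoints n L) = [exists A in [set:: map chord_set L], x \in A].
Proof.
rewrite endpoints_chords mem_cat; apply/idP/exists_inP.
  case/orP => /mapP[B BL xB]; exists (chord_set B); rewrite ?inE ?map_f//.
  - by rewrite -xB eqxx.
  - by rewrite -xB eqxx orbT.
move=> [A]; rewrite inE => /mapP[B BL ->]; rewrite in_chord_set /= => /orP[]/eqP->.
- by rewrite map_f.
- by rewrite (map_f snd BL) orbT.
Qed.

Lemma sum_card_chords : uniq L ->
  \sum_(A in [set:: map chord_set L]) #|A| = size (endpoints n L).
Proof.
move=> uL; rewrite endpoints_chords size_cat !size_map addnn -muln2.
rewrite (eq_bigr (fun=> 2)); last first.
  by move=> A; rewrite inE => /mapP[B BL ->]; rewrite card_chord_set ?(allP cL).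
rewrite sum_nat_const -(size_map chord_set L); congr (_ * _)%N.
rewrite -[RHS](card_uniqP _) ?map_inj_in_uniq//; last exact: chord_set_inj_in.
by apply: eq_card => A; rewrite inE.
Qed.

(** Both directions are a count: the endpoints of [L] cover [0, ..., n - 1] and
number twice the blocks, so they are distinct exactly when the blocks are
disjoint. *)
Lemma partition_chords :
  uniq (map chord_set L) && partition [set:: map chord_set L] [set: 'I_n] =
  perm_eq (endpoints n L) (iota 0 n).
Proof.
rewrite map_inj_in_uniq; last exact: chord_set_inj_in.
have lt x : x \in endpoints n L -> x < n.
  rewrite endpoints_chords mem_cat => /orP[]/mapP[B BL ->];
    have /andP[Blt] := allP cL _ BL => //; exact: ltn_trans.
apply/andP/idP.
  move=> [uL /and3P[/eqP cov tI _]].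
  (* A list that contains [iota 0 n] and has [n] entries has no repetition. *)
  apply: uniq_perm.
  - apply: (@leq_size_uniq _ (iota 0 n)); rewrite ?iota_uniq//.
      move=> x; rewrite mem_iota add0n => /andP[_ xn].
      rewrite -[x]/(val (Ordinal xn)) mem_endpoints.
      have : Ordinal xn \in [set: 'I_n] by rewrite inE.
      by rewrite -cov => /bigcupP[A AP xA]; apply/exists_inP; exists A.
    by rewrite -sum_card_chords// (eqP tI) cov cardsT card_ord size_iota.
  - exact: iota_uniq.
  - move=> x; rewrite mem_iota add0n leq0n /=; apply/idP/idP => [|xn]; first exact: lt.
    rewrite -[x]/(val (Ordinal xn)) mem_endpoints.
    have : Ordinal xn \in [set: 'I_n] by rewrite inE.
    by rewrite -cov => /bigcupP[A AP xA]; apply/exists_inP; exists A.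
move=> e; have uL : uniq L.
  by have := perm_uniq e; rewrite iota_uniq cat_uniq => /andP[/map_uniq].
have cov : cover [set:: map chord_set L] = [set: 'I_n].
  apply/setP => x; rewrite inE; apply/bigcupP.
  have : val x \in endpoints n L by rewrite (perm_mem e) mem_iota leq0n add0n /=.
  by rewrite mem_endpoints => /exists_inP[A AL xA]; exists A.
split => //; apply/and3P; split.
- by rewrite cov.
- by rewrite /trivIset sum_card_chords// cov cardsT card_ord (perm_size e) size_iota.
- rewrite inE; apply/mapP => -[B BL /(congr1 (fun A : {set 'I_n} => #|A|))].
  by rewrite cards0 card_chord_set// (allP cL).
Qed.

Lemma noncrossing_chords :
  noncrossing [set:: map chord_set L] =
  all (fun B => all (fun C => ~~ crossing B C) L) L.
Proof.
apply/idP/allP.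
  move=> /forall_inP nc B BL; apply/allP => C CL; apply/negP => cr.
  have [i [j [iB jB EB]]] := chord_setE (allP cL _ BL).
  have [i' [j' [iC jC EC]]] := chord_setE (allP cL _ CL).
  have /nc/forall_inP/(_ (chord_set C)) : chord_set B \in [set:: map chord_set L].
    by rewrite inE map_f.
  rewrite inE map_f// => /(_ isT)/implyP.
  have -> : chord_set B != chord_set C.
    apply/eqP => /(chord_set_inj_in BL CL) E; move: cr.
    by rewrite /crossing E ltnn.
  move=> /(_ isT)/negP; apply.
  apply/exists_inP; exists i; first by rewrite EB !inE eqxx.
  apply/exists_inP; exists i'; first by rewrite EC !inE eqxx.
  apply/exists_inP; exists j; first by rewrite EB !inE eqxx orbT.
  apply/exists_inP; exists j'; first by rewrite EC !inE eqxx orbT.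
  by rewrite iB iC jB jC.
move=> nc; apply/forall_inP => A; rewrite inE => /mapP[B BL ->].
apply/forall_inP => A'; rewrite inE => /mapP[C CL ->]; apply/implyP => _.
apply/negP => /exists_inP[k]; rewrite in_chord_set => kB.
move=> /exists_inP[m]; rewrite in_chord_set => mC.
move=> /exists_inP[k']; rewrite in_chord_set => k'B.
move=> /exists_inP[m']; rewrite in_chord_set => m'C.
have := allP (nc _ BL) _ CL; have := allP cL _ BL; have := allP cL _ CL.
rewrite /crossing /chord; move: kB mC k'B m'C.
case: B BL => a b _; case: C CL => c d _ /=; lia.
Qed.

Lemma ONC2_chords : ONC2 (map chord_set L) = valid n n L.
Proof.
rewrite /ONC2 /ONC andbA partition_chords noncrossing_chords /valid.
rewrite [X in _ && X](_ : _ = true); last first.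
  by apply/allP => _ /mapP[B BL ->]; rewrite card_chord_set// (allP cL).
rewrite andbT [X in [&& X, _ & _]](_ : _ = true)//.
by apply/allP => B /(allP cL) /andP[h1 h2]; rewrite h1 h2 orbT (ltn_trans h1 h2).
Qed.

Hypothesis vL : valid n n L.

(** By non-crossing, a chord that starts inside another one also ends inside it. *)
Lemma inner_lt_chords B C : B \in L -> C \in L ->
  inner_lt (chord_set B) (chord_set C) = encloses B C.
Proof.
move=> BL CL; have [i [j [iB jB EB]]] := chord_setE (allP cL _ BL).
have [i' [j' [iC jC EC]]] := chord_setE (allP cL _ CL).
have cB := allP cL _ BL; have cC := allP cL _ CL.
apply/idP/idP.
  move=> /exists_inP[a aB] /exists_inP[b bB] /forall_inP h.
  have := h i'; rewrite EC !inE eqxx => /(_ isT).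
  move: aB bB cB cC; rewrite !in_chord_set /encloses /chord iC; lia.
rewrite /encloses => h.
have nc : ~~ crossing B C by have /and3P[_ _ /allP/(_ _ BL)/allP/(_ _ CL)] := vL.
have ne : B.2 != C.2.
  apply/eqP => E; have [_ _] := valid_uniq vL.
  rewrite (_ : [seq _ <- _ | _] = map snd L); last first.
    apply/all_filterP/allP => x /mapP[D DL ->].
    by have /andP[] := allP cL _ DL.
  move=> u; have ED : B = C.
    have /(congr1 (nth (0,0) L)) : index B L = index C L.
      apply/eqP; rewrite -(nth_uniq 0 _ _ u) ?size_map ?index_mem//.
      by rewrite !(nth_map (0,0)) ?index_mem// !nth_index// E.
    by rewrite !nth_index.
  by move: h; rewrite ED ltnn.
apply/exists_inP; exists i; first by rewrite EB !inE eqxx.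
apply/exists_inP; exists j; first by rewrite EB !inE eqxx orbT.
apply/forall_inP => c; rewrite in_chord_set iB jB.
move: nc ne h cB cC; rewrite /crossing /chord; lia.
Qed.

Lemma inner_cover_chords B C : B \in L -> C \in L ->
  inner_cover [set:: map chord_set L] (chord_set B) (chord_set C) = parent L B C.
Proof.
move=> BL CL; rewrite /inner_cover /parent inner_lt_chords//; congr (_ && ~~ _).
apply/exists_inP/hasP => [[A]|[D DL h]].
  rewrite inE => /mapP[D DL ->]; rewrite !inner_lt_chords//.
  by exists D.
by exists (chord_set D); rewrite ?inE ?map_f// !inner_lt_chords.
Qed.

Lemma weight_chords (R : numDomainType) (p q : R) :
  weight p q (map chord_set L) = partial_weight p q L.
Proof.
have [uL _ _] := valid_uniq vL.
pose B0 := (0, 0)%N.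
have cov (i j : 'I_(size (map chord_set L))) :
    inner_cover [set:: map chord_set L] (nth set0 (map chord_set L) i) (nth set0 (map
      chord_set L) j)
    = parent L (nth B0 L i) (nth B0 L j).
  have iL : i < size L by rewrite -(size_map chord_set L).
  have jL : j < size L by rewrite -(size_map chord_set L).
  by rewrite !(nth_map B0)// inner_cover_chords// mem_nth.
rewrite /weight /stat_e /stat_e' -!prodr_const /partial_weight.
rewrite (big_nth B0) -(size_map chord_set L) big_mkord.
under [RHS]eq_bigr do rewrite (big_nth B0) -(size_map chord_set L) big_mkord.
rewrite pair_big_dep /=.
pose N := size (map chord_set L).
rewrite [RHS](bigID (fun ij : 'I_N * 'I_N => (ij.1 < ij.2)%N)) /=; congr (_ * _)%R.
  apply: eq_big => [[i j]|[i j]].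
    by rewrite inE /= cov andbC.
  rewrite inE => /andP[/= ij _].
  have iL : i < size L by rewrite -(size_map chord_set L).
  have jL : j < size L by rewrite -(size_map chord_set L).
  by rewrite !index_uniq// ij.
rewrite [RHS](reindex_inj (h := fun ij : 'I_N * 'I_N => (ij.2, ij.1))) /=; last first.
  by move=> [i j] [i' j'] [-> ->].
apply: eq_big => [[i j]|[i j] /=].
  rewrite inE /= cov /parent /encloses; case: (ltngtP i j) => // ij; rewrite ?andbF ?andbT//.
  by rewrite ij ltnn.
rewrite inE /= cov => /andP[ij _].
have iL : i < size L by rewrite -(size_map chord_set L).
have jL : j < size L by rewrite -(size_map chord_set L).
by rewrite !index_uniq// ltnNge (ltnW ij).
Qed.

Lemma size_chords : size L <= n.
Proof.
have /and3P[_ /perm_size + _] := vL.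
by rewrite size_cat size_map size_iota => <-; exact: leq_addr.
Qed.

End chords.

Lemma sum_ONC2 (R : nmodType) (F : seq {set 'I_n} -> R) (Q : pred (seq {set 'I_n})) :
  (\sum_(P : n.-bseq {set 'I_n} | ONC2 P && Q P) F P)%R =
  (\sum_(L <- states n n | all chord L && Q (map chord_set L)) F (map chord_set L))%R.
Proof.
have sP : perm_eq [seq val P | P : n.-bseq {set 'I_n} <- enum {: n.-bseq {set 'I_n}} & ONC2 P]
    [seq map chord_set L | L <- [seq L <- states n n | all chord L]].
  apply: uniq_perm.
  - by rewrite (map_inj_uniq val_inj) filter_uniq// enum_uniq.
  - rewrite map_inj_in_uniq ?filter_uniq ?uniq_states// => L L'.
    rewrite !mem_filter => /andP[cL _] /andP[cL' _].
    elim: L L' cL cL' => [|B L IH] [|C L']//= /andP[cB cL] /andP[cC cL'] [/chord_set_inj ->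
      // /IH -> //].
  - move=> P; apply/mapP/mapP.
      move=> [X]; rewrite mem_filter => /andP[oX _] ->.
      have [L cL XL] := chords_of_pairs (proj2 (andP oX)); exists L => //.
      by rewrite mem_filter cL states_valid// -ONC2_chords// -XL.
    move=> [L]; rewrite mem_filter states_valid// => /andP[cL vL] ->.
    have sz : size (map chord_set L) <= n by rewrite size_map size_chords.
    by exists (Bseq sz) => //; rewrite mem_filter /= mem_enum ONC2_chords// vL.
transitivity (\sum_(P <- [seq val P | P : n.-bseq {set 'I_n} <- enum {: n.-bseq {set 'I_n}} &
  ONC2 P] | Q P) F P)%R.
  by rewrite big_map big_filter_cond big_enum_cond.
by rewrite (perm_big _ sP) /= big_map big_filter_cond.
Qed.

End pairings.

From mathcomp Require Import ring lra.
From mathcomp Require Import complex.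
From mathcomp Require Import all_classical all_reals all_analysis.
From mathcomp Require Import measurable_realfun.
Import Order.TTheory GRing.Theory Num.Theory.
Import numFieldNormedType.Exports.
Local Open Scope classical_set_scope.
Local Open Scope complex_scope.
Local Open Scope ring_scope.

(** * Iterated integrals over increasing lists *)

Section indicators.
Variable R : realType.
Local Notation RR := (measurableTypeR R).
Local Notation mu := (mu_half R).

Lemma measurable_supp (t : Theta R) : measurable (supp t : set RR).
Proof. by rewrite suppE; apply: measurable_itv. Qed.

Lemma supp_neq0 (t : Theta R) : supp t (val t).1.
Proof. by rewrite /supp/= lexx; have /andP[] := valP t. Qed.

(** Supports of elements of [Theta] lie in the half line, so restricting Lebesgue
measure to it loses nothing. *)
Lemma mu_supp (t : Theta R) : mu (supp t) = (fine (lebesgue_measure (supp t)))%:E.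
Proof.
rewrite (_ : mu (supp t) = lebesgue_measure (supp t)).
  by rewrite suppE lebesgue_measure_itv /=; case: ifP.
rewrite /mu_half /= /lebesgue_restr /mrestr; congr lebesgue_measure.
apply/setIidPl => x /andP[x0 _]; rewrite /= in_itv /= andbT.
by have /andP[t0 _] := valP t; exact: le_trans x0.
Qed.

Definition good_fun (f : R -> R) :=
  (forall s, 0 <= f s) /\ measurable_fun [set: RR] (f : RR -> RR).

Lemma good_chi (f : Theta R) : good_fun (chi f).
Proof.
split=> [s|]; first by rewrite /chi indicE.
apply: (@measurable_indic _ RR R setT (supp f)).
exact: measurable_supp.
Qed.

End indicators.

Section iterated.
Variable R : realType.
Local Notation RR := (measurableTypeR R).
Local Notation mu := (mu_half R).
Implicit Types (K : seq R -> \bar R) (x : seq R) (s : R).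

(** Measurability of a map into lists of a constant length.  Lists rather than
tuples keep insertions and deletions free of casts. *)
Definition seq_measurable d (T : measurableType d) (phi : T -> seq RR) :=
  (exists m, forall y, size (phi y) = m) /\
  forall i, measurable_fun [set: T] (fun y => nth 0 (phi y) i : RR).

Section seq_measurable.
Context d (T : measurableType d).
Implicit Types phi psi : T -> seq RR.

Lemma seq_measurable_tuple m (g : T -> m.-tuple RR) :
  measurable_fun setT g -> seq_measurable (fun y => tval (g y)).
Proof.
move=> mg; split; first by exists m => y; rewrite size_tuple.
move=> i; have [im|im] := ltnP i m.
  have := (measurable_fun_tnthP g).1 mg (Ordinal im).
  by congr (measurable_fun _ _); apply/funext => y /=; rewrite (tnth_nth 0).
rewrite (_ : (fun _ => _) = fun=> 0); first exact: measurable_cst.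
by apply/funext => y; rewrite nth_default// size_tuple.
Qed.

Lemma tuple_seq_measurable phi : seq_measurable phi ->
  exists m (g : T -> m.-tuple RR), measurable_fun setT g /\ forall y, phi y = g y.
Proof.
move=> [[m sm] mp].
have sp y : size (phi y) == m by rewrite sm.
exists m, (fun y => Tuple (sp y)); split => //.
apply/measurable_fun_tnthP => i; have := mp i.
by congr (measurable_fun _ _); apply/funext => y /=; rewrite (tnth_nth 0).
Qed.

Lemma seq_measurable_nil : seq_measurable (fun _ : T => [::]).
Proof.
by split; [exists 0%N|move=> i; rewrite (_ : (fun _ => _) = fun=> 0);
  [exact: measurable_cst|apply/funext => y; rewrite nth_nil]].
Qed.

Lemma seq_measurable_cons (a : T -> RR) phi : measurable_fun setT a ->
  seq_measurable phi -> seq_measurable (fun y => a y :: phi y).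
Proof.
move=> ma [[m sm] mp]; split; first by exists m.+1 => y; rewrite /= sm.
by case=> [|i] /=; [exact: ma|exact: mp].
Qed.

Lemma seq_measurable_drop j phi : seq_measurable phi ->
  seq_measurable (fun y => drop j (phi y)).
Proof.
move=> [[m sm] mp]; split; first by exists (m - j)%N => y; rewrite size_drop sm.
by move=> i; under eq_fun do rewrite nth_drop; exact: mp.
Qed.

Lemma seq_measurable_ins j (a : T -> RR) phi : measurable_fun setT a ->
  seq_measurable phi -> seq_measurable (fun y => ins j (a y) (phi y)).
Proof.
move=> ma [[m sm] mp]; split; first by exists m.+1 => y; rewrite size_ins sm.
move=> i; rewrite (_ : (fun _ => _) = (fun y =>
  if (i < minn j m)%N then nth 0 (phi y) i else
  nth 0 (a y :: drop j (phi y)) (i - minn j m)%N)); last first.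
  apply/funext => y; rewrite /ins nth_cat size_take_min sm.
  by case: ifP => // h; rewrite nth_take// (leq_trans h)// geq_minl.
case: (i < minn j m)%N; first exact: mp.
case: (i - minn j m)%N => [|k] /=; first exact: ma.
by under eq_fun do rewrite nth_drop; exact: mp.
Qed.

Lemma seq_measurable_map (I : Type) (k : seq I) (u : I -> nat) phi :
  seq_measurable phi -> seq_measurable (fun y => [seq nth 0 (phi y) (u i) | i <- k]).
Proof.
move=> [_ mp]; elim: k => [|i k IH] /=; first exact: seq_measurable_nil.
exact: seq_measurable_cons.
Qed.

Lemma measurable_path (a : T -> RR) phi : measurable_fun setT a ->
  seq_measurable phi -> measurable_fun setT (fun y => path <%R (a y : R) (phi y)).
Proof.
move=> ma [[m]]; elim: m a phi ma => [|m IH] a phi ma sm mp.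
  rewrite (_ : (fun _ => _) = fun=> true); first exact: measurable_cst.
  by apply/funext => y; case: (phi y) (sm y).
rewrite (_ : (fun _ => _) = (fun y => (a y < nth 0 (phi y) 0) &&
    path <%R (nth 0 (phi y) 0 : R) (behead (phi y)))); last first.
  by apply/funext => y; case: (phi y) (sm y).
apply: measurable_and; first exact: (measurable_fun_ltr ma (mp 0%N)).
apply: IH => //.
- by move=> y; rewrite size_behead sm.
- by move=> i; under eq_fun do rewrite nth_behead; exact: mp.
Qed.

End seq_measurable.

(** Functions of lists of every length to which Tonelli's theorem applies. *)
Definition tonelli K := (forall x, 0 <= K x)%E /\
  forall m, measurable_fun setT (fun t : m.-tuple RR => K t).

Lemma tonelli_comp d (T : measurableType d) K (phi : T -> seq RR) :
  tonelli K -> seq_measurable phi -> measurable_fun setT (fun y => K (phi y)).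
Proof.
move=> [_ mK] /tuple_seq_measurable[m [g [mg E]]].
by under eq_fun do rewrite E; exact: measurableT_comp (mK m) mg.
Qed.

Lemma seq_measurable_id m : seq_measurable (fun t : m.-tuple RR => tval t).
Proof. exact: (@seq_measurable_tuple _ _ m id). Qed.

Lemma tonelli_int (K : R -> seq R -> \bar R) :
  tonelli (fun x => K (head 0 x) (behead x)) ->
  tonelli (fun x => \int[mu]_s K s x)%E.
Proof.
move=> [K0 mK]; split; first by move=> x; apply: integral_ge0 => s _; exact: (K0 (s :: x)).
move=> m.
have := @measurable_fun_fubini_tonelli_G _ _ RR _ R mu
  (fun z : RR * m.-tuple RR => K z.1 z.2).
apply; last by move=> z; exact: (K0 (z.1 :: tval z.2)).
have := @tonelli_comp _ _ _ (fun z : RR * m.-tuple RR => z.1 :: tval z.2) (conj K0 mK).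
by apply; apply: seq_measurable_cons => //; exact: (seq_measurable_tuple measurable_snd).
Qed.

Lemma tonelli_shift K (phi : seq R -> seq R) :
  (forall m, seq_measurable (fun t : m.-tuple RR => phi t)) ->
  tonelli K -> tonelli (fun x => K (phi x)).
Proof.
by move=> mp tK; split => [x|m]; [exact: tK.1|exact: tonelli_comp].
Qed.

Lemma tonelliM K K' : tonelli K -> tonelli K' -> tonelli (fun x => K x * K' x)%E.
Proof.
move=> [K0 mK] [K0' mK']; split => [x|m]; first exact: mule_ge0.
exact: emeasurable_funM (mK m) (mK' m).
Qed.

Lemma tonelli_if (b : seq R -> bool) K :
  (forall m, measurable_fun setT (fun t : m.-tuple RR => b t)) ->
  tonelli K -> tonelli (fun x => if b x then K x else 0%E).
Proof.
move=> mb [K0 mK]; split => [x|m]; first by case: ifP.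
exact: (measurable_fun_ifT (mb m) (mK m) (measurable_cst 0%E)).
Qed.

(** Taking the first entry as the innermost variable makes the removal of an entry in
front a mere unfolding; only the other places require Tonelli's theorem. *)
Fixpoint iter_int N K : \bar R :=
  if N is N'.+1 then iter_int N' (fun x => \int[mu]_s K (s :: x))%E else K [::].

Lemma iter_intS N K : iter_int N.+1 K = iter_int N (fun x => \int[mu]_s K (s :: x))%E.
Proof. by []. Qed.

Lemma tonelli_eta K : tonelli K -> tonelli (fun x : seq R => K (head 0 x :: behead x)).
Proof.
move=> tK; apply: (@tonelli_shift K (fun x => head 0 x :: behead x)) => // m.
have idm := seq_measurable_id m.
apply: seq_measurable_cons; first by under eq_fun do rewrite -nth0; exact: idm.2.
by under eq_fun do rewrite -drop1; exact: seq_measurable_drop.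
Qed.

Lemma tonelli_int_cons K : tonelli K -> tonelli (fun x => \int[mu]_s K (s :: x))%E.
Proof. by move=> tK; apply: (@tonelli_int (fun s x => K (s :: x))); exact: tonelli_eta. Qed.

Lemma eq_iter_int N K K' : (forall x, size x = N -> K x = K' x) -> iter_int N K = iter_int N K'.
Proof.
elim: N K K' => [|N IH] K K' KK' /=; first exact: KK'.
by apply: IH => x xN; apply: eq_integral => s _; apply: KK'; rewrite /= xN.
Qed.

Lemma iter_int_sum N (I : Type) (r : seq I) (F : I -> seq R -> \bar R) :
  (forall i, tonelli (F i)) ->
  iter_int N (fun x => \sum_(i <- r) F i x)%E = (\sum_(i <- r) iter_int N (F i))%E.
Proof.
elim: N F => [//|N IH] F tF /=.
rewrite -IH; last by move=> i; exact: tonelli_int_cons.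
apply: eq_iter_int => x _; rewrite ge0_integral_sum// => i.
  have -> : (fun s => F i (s :: x)) = (F i) \o (fun s : RR => s :: x) by [].
  apply: tonelli_comp => //; apply: seq_measurable_cons => //.
  split; first by exists (size x).
  by move=> k; exact: measurable_cst.
by move=> s _; exact: (tF i).1.
Qed.

Lemma measurable_cons_cst K x : tonelli K -> measurable_fun setT (fun s : RR => K (s :: x)).
Proof.
move=> tK; apply: tonelli_comp => //; apply: seq_measurable_cons => //.
by split; [exists (size x)|move=> k; exact: measurable_cst].
Qed.

Lemma iter_intZl N c K : (0 <= c)%E -> tonelli K -> iter_int N (fun x => c * K x)%E =
  (c * iter_int N K)%E.
Proof.
move=> c0; elim: N K => [//|N IH] K tK /=.
rewrite -IH; last exact: tonelli_int_cons.
apply: eq_iter_int => x _; rewrite ge0_integralZl//; first exact: measurable_cons_cst.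
by move=> s _; exact: tK.1.
Qed.

Lemma iter_int0 N : iter_int N (fun=> 0%E) = 0%E.
Proof. by elim: N => [//|N IH] /=; rewrite -[RHS]IH; apply: eq_iter_int => x _;
  rewrite integral0. Qed.

(** Tonelli's theorem moves the variable at place [j] to the innermost position. *)
Lemma iter_int_ins N j K : tonelli K -> (j <= N)%N ->
  iter_int N.+1 K = iter_int N (fun x => \int[mu]_s K (ins j s x))%E.
Proof.
elim: N j K => [|N IH] j K tK; first by rewrite leqn0 => /eqP ->.
rewrite [LHS]iter_intS; case: j => [_|j jN].
  by apply: (@eq_iter_int N.+1) => x _; apply: eq_integral => s _; rewrite /ins take0 drop0.
rewrite (IH j)//; last exact: tonelli_int_cons.
rewrite [RHS]iter_intS; apply: eq_iter_int => x _.
rewrite (@fubini_tonelli _ _ RR RR R mu mu (fun z => K (z.2 :: ins j z.1 x)))//.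
  apply: tonelli_comp => //; apply: seq_measurable_cons => //.
  apply: seq_measurable_ins => //.
  by split; [exists (size x)|move=> k; exact: measurable_cst].
by move=> z; exact: tK.1.
Qed.

Definition rem_nth j x := take j x ++ drop j.+1 x.

Lemma rem_ins j s x : (j <= size x)%N -> rem_nth j (ins j s x) = x.
Proof.
move=> jx; have sj : size (take j x) = j by rewrite size_takel.
rewrite /rem_nth /ins take_size_cat// -cat1s catA drop_size_cat ?cat_take_drop//.
by rewrite size_cat sj addn1.
Qed.

Lemma nth_ins j s x : (j <= size x)%N -> nth 0 (ins j s x) j = s.
Proof. by move=> jx; rewrite /ins nth_cat size_takel// ltnn subnn. Qed.

(** A number that differs from all entries of an increasing list fits into exactly
one gap of the list. *)
Lemma sum_path_ins a s x (c : \bar R) : a < s -> s \notin x ->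
  (\sum_(j <- iota 0 (size x).+1) (if path <%R a (ins j s x) then c else 0) =
   if path <%R a x then c else 0)%E.
Proof.
elim: x a => [|b x IH] a a_s sx; first by rewrite big_seq1 /= a_s.
rewrite [size _]/= (_ : iota 0 (size x).+2 = 0%N :: [seq j.+1 | j <- iota 0 (size x).+1]).
  rewrite big_cons big_map.
  rewrite (_ : ins 0 s (b :: x) = [:: s, b & x])//.
  move: sx; rewrite inE negb_or => /andP[sb sx].
  have insS j : ins j.+1 s (b :: x) = b :: ins j s x by [].
  under eq_bigr do rewrite insS/=.
  rewrite /= a_s /=.
  case: (ltgtP s b) sb => // [sb _|bs _].
    rewrite (lt_trans a_s sb) /= big1 ?adde0// => j _.
    rewrite ifF//; apply/negbTE/negP => /(order_path_min lt_trans)/allP/(_ s).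
    by rewrite (perm_mem (perm_ins _ _ _)) mem_head => /(_ isT); rewrite ltNge (ltW sb).
  rewrite add0e; case: (a < b) => /=; last by rewrite big1.
  exact: IH.
by rewrite -(iotaDl 1 0).
Qed.

Definition increasing x := path <%R 0 x.

Lemma measurable_increasing m : measurable_fun setT (fun t : m.-tuple RR => increasing t).
Proof. by apply: measurable_path; [exact: measurable_cst|exact: seq_measurable_id]. Qed.

(** Nonpositive numbers are null for [mu_half], and so is a finite set. *)
Lemma ae_generic x : {ae mu, forall s, 0 < s /\ s \notin x}.
Proof.
have cx : countable ([set` x] : set RR) by exact/finite_set_countable/finite_seq.
pose A : set RR := `]-oo, 0] `|` [set` x].
exists A; split.
- by apply: measurableU => //; apply: countable_measurable.
- apply: countable_lebesgue_measure0.
  apply: (@sub_countable _ _ _ [set` 0 :: x]).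
    apply: subset_card_le => s [[|sx _]]; last by rewrite /= inE sx orbT.
    by rewrite /= !in_itv /= andbT inE => s0 s1; apply/orP; left; rewrite eq_le s0.
  exact/finite_set_countable/finite_seq.
- move=> s /= /not_andP[/negP|/negP]; first by rewrite -leNgt; left; rewrite /= in_itv.
  by rewrite negbK; right.
Qed.

(** Splitting an extra variable according to its place among the others: the
central step, both for the expansion over histories and for the volumes. *)
Lemma iter_int_split N (K : R -> seq R -> \bar R) :
  tonelli (fun x => K (head 0%R x) (behead x)) ->
  iter_int N (fun x => if increasing x then \int[mu]_s K s x else 0)%E =
  (\sum_(j <- iota 0 N.+1)
    iter_int N.+1 (fun y => if increasing y then K (nth 0%R y j) (rem_nth j y) else 0))%E.
Proof.
move=> tK.
pose F j y := if increasing y then K (nth 0%R y j) (rem_nth j y) else 0%E.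
have tF j : tonelli (F j).
  apply: tonelli_if; first exact: measurable_increasing.
  apply: (@tonelli_shift (fun x => K (head 0%R x) (behead x))
     (fun x => nth 0%R x j :: rem_nth j x)) => // m.
  have idm := seq_measurable_id m.
  apply: seq_measurable_cons; first exact: idm.2.
  split; first by exists (minn j m + (m - j.+1))%N => t;
    rewrite size_cat size_take_min size_drop size_tuple.
  move=> i; under eq_fun do rewrite nth_cat size_take_min size_tuple nth_drop.
  case: (ltnP i (minn j m)) => h; last exact: idm.2.
  under eq_fun do rewrite nth_take ?(leq_trans h) ?geq_minl//.
  exact: idm.2.
transitivity (iter_int N (fun x => \sum_(j <- iota 0 N.+1) \int[mu]_s F j (ins j s x)))%E.
  apply: eq_iter_int => x xN.
  have mF j : measurable_fun setT (fun s : RR => F j (ins j s x)).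
    apply: tonelli_comp => //; apply: seq_measurable_ins => //.
    by split; [exists (size x)|move=> k; exact: measurable_cst].
  have F0 j s : (0 <= F j (ins j s x))%E by exact: (tF j).1.
  rewrite -ge0_integral_sum//.
  have tK' : measurable_fun setT (fun s : RR => K s x).
    by have := measurable_cons_cst x tK.
  have K0 s : (0 <= K s x)%E by exact: (tK.1 (s :: x)).
  transitivity (\int[mu]_s if increasing x then K s x else 0)%E.
    by case: (increasing x) => //; rewrite integral0.
  apply: ge0_ae_eq_integral => //.
  - by case: (increasing x) => //; exact: measurable_cst.
  - exact: emeasurable_sum.
  - by move=> s _; case: ifP.
  - by move=> s _; exact: sume_ge0.
  have := ae_generic x; apply: filterS; first exact: (ae_filter_ringOfSetsType mu).
  move=> s [s0 sx] _.
  rewrite -xN -(sum_path_ins (K s x) s0 sx); apply: eq_big_seq => j.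
  by rewrite mem_iota add0n ltnS /F => /= jx; rewrite nth_ins// rem_ins.
rewrite iter_int_sum.
  by apply: eq_big_seq => j; rewrite mem_iota add0n ltnS => /= jN; rewrite -iter_int_ins.
move=> j; apply: (@tonelli_int (fun s x => F j (ins j s x))).
apply: (@tonelli_shift (F j) (fun x => ins j (head 0%R x) (behead x))) => // m.
have idm := seq_measurable_id m.
apply: seq_measurable_ins; first by under eq_fun do rewrite -nth0; exact: idm.2.
by under eq_fun do rewrite -drop1; exact: seq_measurable_drop.
Qed.

End iterated.

Lemma ins_rem_nth (R : realType) j (y : seq R) : (j < size y)%N ->
  ins j (nth 0 y j) (rem_nth j y) = y.
Proof.
move=> jy; have sj : size (take j y) = j by rewrite size_takel// ltnW.
by rewrite /ins /rem_nth take_size_cat// drop_size_cat// -drop_nth// cat_take_drop.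
Qed.

Lemma iter_int_ge0 (R : realType) N (K : seq R -> \bar R) :
  (forall x, 0 <= K x)%E -> (0 <= iter_int N K)%E.
Proof.
elim: N K => [|N IH] K K0 /=; first exact: K0.
apply: IH => x.
by apply: integral_ge0 => s _; exact: K0.
Qed.

Section products.
Variable R : realType.
Local Notation RR := (measurableTypeR R).
Local Notation mu := (mu_half R).
Variables (I : Type) (phi : I -> R -> R).
Hypothesis phi0 : forall i s, 0 <= phi i s.
Hypothesis mphi : forall i, measurable_fun [set: RR] (phi i : RR -> RR).

Fixpoint prod_along (L : seq I) (x : seq R) : R :=
  if (L, x) is (i :: L', s :: x') then phi i s * prod_along L' x' else 1.

Lemma prod_along_ge0 L x : 0 <= prod_along L x.
Proof. by elim: L x => [|i L IH] [|s x] //=; rewrite mulr_ge0. Qed.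

Lemma prod_along_ins L x i s j : size L = size x ->
  prod_along (ins j i L) (ins j s x) = phi i s * prod_along L x.
Proof.
elim: L x j => [|i' L IH] [|s' x] [|j]//= [Lx].
by rewrite -/(ins j i L) -/(ins j s x) IH// mulrCA.
Qed.

Lemma tonelli_prod_along L : tonelli (fun x => (prod_along L x)%:E).
Proof.
split => [x|m]; first by rewrite lee_fin prod_along_ge0.
apply/measurable_EFinP.
suff H d (T : measurableType d) (psi : T -> seq RR) : seq_measurable psi ->
    measurable_fun setT (fun y => prod_along L (psi y) : RR).
  exact: (H _ _ _ (seq_measurable_id R m)).
elim: L d T psi => [|i L IH] d T psi mp; first exact: measurable_cst.
have [k sk] := mp.1; case: k sk => [|k] sk.
  rewrite (_ : (fun _ => _) = fun=> 1); first exact: measurable_cst.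
  by apply/funext => y; case: (psi y) (sk y).
rewrite (_ : (fun _ => _) = fun y => phi i (nth 0 (psi y) 0) * prod_along L (drop 1 (psi y))).
  apply: measurable_funM; last exact/IH/seq_measurable_drop.
  exact: (measurableT_comp (mphi i) (mp.2 0%N)).
by apply/funext => y; case: (psi y) (sk y) => //= a s _; rewrite drop0.
Qed.

(** The form of [iter_int_split] in which the new variable brings a label [i] and
its factor [phi i] along, so that the labels are inserted at the same place. *)
Lemma iter_int_insert N L i (K : R -> seq R -> \bar R) : size L = N ->
  tonelli (fun x => K (head 0 x) (behead x)) ->
  iter_int N (fun x => if increasing x then (prod_along L x)%:E * \int[mu]_s ((phi i s)%:E *
    K s x) else 0)%E
  = (\sum_(j <- iota 0 N.+1)
    iter_int N.+1 (fun y => if increasing y then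
      (prod_along (ins j i L) y)%:E * K (nth 0%R y j) (rem_nth j y) else 0))%E.
Proof.
move=> LN tK.
have mfi x : measurable_fun setT (fun s : RR => (phi i s)%:E * K s x)%E.
  apply: emeasurable_funM; first by apply/measurable_EFinP; exact: mphi.
  by have := measurable_cons_cst x tK.
transitivity (iter_int N (fun x => if increasing x then
    \int[mu]_s ((prod_along L x)%:E * ((phi i s)%:E * K s x)) else 0))%E.
  apply: eq_iter_int => x _; rewrite ge0_integralZl//.
    by move=> s _; rewrite mule_ge0// ?lee_fin//; exact: (tK.1 (s :: x)).
  by rewrite lee_fin prod_along_ge0.
rewrite (iter_int_split N (K := fun s x => (prod_along L x)%:E * ((phi i s)%:E * K s x))%E).
  apply: eq_big_seq => j; rewrite mem_iota add0n ltnS => /andP[_ jN].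
  apply: eq_iter_int => y yN; case: (increasing y) => //; rewrite muleA -EFinM mulrC;
    congr (_%:E * _)%E.
  rewrite -[X in _ = prod_along (ins j i L) X](@ins_rem_nth _ j) ?yN ?ltnS// prod_along_ins//.
  by rewrite LN /rem_nth size_cat size_drop size_takel ?yN ?leqW//; lia.
apply: tonelliM.
  apply: (@tonelli_shift R (fun x => (prod_along L x)%:E) behead);
    last exact: tonelli_prod_along.
  move=> m; under eq_fun do rewrite -drop1;
    exact: (seq_measurable_drop 1 (seq_measurable_id R m)).
apply: tonelliM => //; split => [x|m]; first by rewrite lee_fin.
apply/measurable_EFinP; apply: (measurableT_comp (mphi i)).
by under eq_fun do rewrite -nth0; exact: (seq_measurable_id R m).2.
Qed.

End products.

Lemma ins_nseq (T : Type) j k (c : T) t : (j <= k)%N ->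
  ins j c (nseq k c ++ t) = c :: nseq k c ++ t.
Proof.
elim: j k => [|j IH] k jk; first by rewrite /ins take0 drop0.
by case: k jk => [//|k] jk; transitivity (c :: ins j c (nseq k c ++ t)); [|rewrite IH].
Qed.

(** * Volumes of ordered boxes *)

Section volumes.
Variable R : realType.
Local Notation RR := (measurableTypeR R).
Local Notation mu := (mu_half R).
Variables (J : nat -> set R) (l : nat -> R) (r : nat).
Hypothesis mJ : forall c, measurable (J c : set RR).
Hypothesis J_lt : forall c c', (c < c' < r)%N -> set_lt (J c) (J c').
Hypothesis J_len : forall c, (c < r)%N -> mu (J c) = (l c)%:E.

Let ind c s : R := \1_(J c) s.
Let ind0 c s : 0 <= ind c s.
Proof. by rewrite /ind indicE. Qed.
Let mind c : measurable_fun [set: RR] (ind c : RR -> RR).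
Proof. exact: (@measurable_indic _ RR R setT (J c)). Qed.

Definition simplex_vol (cs : seq nat) : \bar R :=
  iter_int (size cs) (fun x => if increasing x then (prod_along ind cs x)%:E else 0%E).

(** Integrating an additional variable over [J c] gives the factor [l c]; splitting
it by its place gives the sum. *)
Lemma simplex_vol_ins cs c : (c < r)%N ->
  ((l c)%:E * simplex_vol cs = \sum_(j <- iota 0 (size cs).+1) simplex_vol (ins j c cs))%E.
Proof.
move=> cr; have lc0 : (0 <= (l c)%:E)%E by rewrite -J_len// measure_ge0.
rewrite /simplex_vol -iter_intZl//; last first.
  by apply: tonelli_if; [exact: measurable_increasing|exact: tonelli_prod_along].
rewrite (_ : (fun x => _) = fun x => if increasing x then (prod_along ind cs x)%:E *
    \int[mu]_s ((ind c s)%:E * 1) else 0)%E; last first.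
  apply/funext => x; case: ifP => _; last by rewrite mule0.
  rewrite muleC; congr (_ * _)%E.
  under eq_integral do rewrite mule1.
  by rewrite /ind integral_indic// setIT; exact/esym/J_len.
rewrite (iter_int_insert ind0 mind c (K := fun _ _ => 1%E))//.
apply: eq_bigr => j _; rewrite size_ins; apply: eq_iter_int => y _.
by rewrite mule1.
Qed.

Lemma simplex_vol_unsorted cs : all (fun c => c < r)%N cs -> ~~ sorted leq cs ->
  simplex_vol cs = 0%E.
Proof.
move=> cr us; rewrite /simplex_vol -[RHS](iter_int0 R (size cs)); apply: eq_iter_int => x xs.
case: ifP => // ix; apply/eqP; rewrite eqe; apply/negPn; apply: contra us => nz.
move: nz ix; rewrite /increasing; set a := (X in path _ X _) => nz; move: a => a ix.
move: nz ix; elim: cs x a cr xs => [//|c cs IH] [//|s x] a /= /andP[cr cr'] [xs].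
rewrite mulf_eq0 negb_or => /andP[ns nz] /andP[a_s sx]; have {}IH := IH _ _ cr' xs nz sx.
case: cs x cr' xs sx nz IH => [//|c' cs] [//|s' x] /= /andP[cr' _] _ /andP[ss' _].
rewrite mulf_eq0 negb_or => /andP[ns' _] IH; rewrite IH andbT leqNgt.
apply/negP => cc; have /J_lt : (c' < c < r)%N by rewrite cc.
move: ns ns'; rewrite /ind !indicE.
case: (boolP (s \in J c)); rewrite ?eqxx// inE => Js _.
case: (boolP (s' \in J c')); rewrite ?eqxx// inE => Js' _.
by move=> /(_ _ _ Js' Js); rewrite ltNge (ltW ss').
Qed.

(** Remove the first label [c] and let [k] be the number of its remaining
occurrences.  Among the ways to put [c] back, the [k + 1] places before or inside
the run of copies of [c] restore the list, and the others give unsorted lists of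
volume zero; hence [l c * simplex_vol cs = (k + 1) * simplex_vol (c :: cs)]. *)
Lemma simplex_vol_sorted cs : all (fun c => c < r)%N cs -> sorted leq cs ->
  simplex_vol cs = (\prod_(c < r) (l c ^+ count_mem (c : nat) cs / (count_mem (c : nat)
    cs)`!%:R))%:E.
Proof.
elim: cs => [_ _|c cs IH /= /andP[cr ccr] scs].
  rewrite /simplex_vol /= big1// => i _; by rewrite expr0 fact0 invr1 mulr1.
have ss : sorted leq cs by exact: path_sorted scs.
have cle : all (leq c) cs by apply: order_path_min scs; exact: leq_trans.
pose k := count_mem c cs.
have E : ((l c)%:E * simplex_vol cs = (k.+1%:R)%:E * simplex_vol (c :: cs))%E.
  rewrite simplex_vol_ins//.
  have csE : cs = nseq k c ++ drop k cs.
    rewrite /k; elim: (cs) ss cle => [//|d s IHs] /= ps /andP[cd cs'].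
    have ss' := path_sorted ps.
    case: (eqVneq d c) ps => [->|dc] ps /=.
      by rewrite /= add0n; congr cons; exact: IHs.
    have -> : count_mem c s = 0%N; last by rewrite addn0 drop0.
    apply/count_memPn; apply/negP => /(allP (order_path_min leq_trans ps)) dc'.
    by case/negP: dc; rewrite eqn_leq dc' cd.
  have insE j : (j <= k)%N -> ins j c cs = c :: cs.
    by move=> jk; rewrite csE ins_nseq.
  have kcs : (k <= size cs)%N by exact: count_size.
  pose s := iota 0 (size cs).+1; rewrite -/s.
  rewrite (bigID (fun j => j <= k)%N) /= [X in (_ + X)%E]big1_seq ?adde0.
    rewrite (eq_bigr (fun=> simplex_vol (c :: cs))); last by move=> j /insE ->.
    rewrite big_const_seq.
    have -> : count (fun j => j <= k)%N s = k.+1.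
      rewrite /s.
      rewrite (_ : (size cs).+1 = k.+1 + (size cs - k))%N; last by lia.
      rewrite iotaD count_cat (eq_in_count (a2 := predT)); last first.
        by move=> j; rewrite mem_iota add0n ltnS => /andP[_ ->].
      rewrite count_predT size_iota (eq_in_count (a2 := pred0)) ?count_pred0 ?addn0//.
      by move=> j; rewrite mem_iota add0n /= => /andP[kj _]; rewrite leqNgt kj.
    have v0 : (0 <= simplex_vol (c :: cs))%E.
      rewrite /simplex_vol; apply: iter_int_ge0 => x; case: ifP => // _.
      by rewrite lee_fin prod_along_ge0.
    elim: (k.+1) => [|m IHm]; first by rewrite /= mul0e.
    by rewrite /= IHm -natr1 EFinD ge0_muleDl ?lee_fin// mul1e addeC.
  move=> j /andP[]; rewrite -ltnNge => kj; rewrite mem_iota add0n ltnS => /= jcs.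
  apply: simplex_vol_unsorted; first by rewrite (perm_all _ (perm_ins _ _ _)) /= cr.
  apply/negP => sI.
  have : (nth 0%N (ins j c cs) k <= nth 0%N (ins j c cs) j)%N.
    apply: (sorted_leq_nth leq_trans leqnn) => //; rewrite ?inE ?size_ins ?ltnS//.
    exact: ltnW.
  have kcs' : (k < size cs)%N by exact: leq_trans jcs.
  rewrite /ins !nth_cat size_takel// kj ltnn subnn /= nth_take//.
  have : nth 0%N cs k != c.
    apply/negP => /eqP kc.
    have : count_mem c cs = k by [].
    rewrite -[in count_mem c cs](cat_take_drop k.+1 cs) count_cat.
    rewrite (take_nth 0%N)// kc -cats1 count_cat /= eqxx addn0.
    rewrite [X in take _ X]csE take_size_cat ?size_nseq// count_nseq /= eqxx; lia.
  have : (c <= nth 0 cs k)%N by apply: (allP cle); exact: mem_nth.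
  lia.
have -> : simplex_vol (c :: cs) = ((k.+1%:R^-1)%:E * ((k.+1%:R)%:E * simplex_vol (c :: cs)))%E.
  by rewrite muleA -EFinM mulVf ?pnatr_eq0// mul1e.
rewrite -E IH// -!EFinM; congr EFin.
rewrite (bigD1 (Ordinal cr))//= [in RHS](bigD1 (Ordinal cr))//= eqxx add1n -/k.
rewrite !mulrA; congr (_ * _).
  rewrite exprS factS natrM invfM; rewrite [X in X * _ * _ = _]mulrC.
  by rewrite -!mulrA; congr (_ * _); rewrite mulrCA mulrA mulrC.
apply: eq_bigr => i ic.
have -> : (c == i) = false; last by rewrite add0n.
by apply/negbTE; apply: contra ic => /eqP ci; apply/eqP/val_inj.
Qed.
End volumes.

(** * Expansion of the stack recursion over histories *)

Section stack.
Variables (n : nat).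

Lemma rev_iotaS k : rev (iota 0 k.+1) = k :: rev (iota 0 k).
Proof. by rewrite -addn1 iotaD rev_cat. Qed.

Lemma open_stack_ins k L j : open_stack n k.+1 (ins j (k, n) L) = k :: open_stack n k L.
Proof.
rewrite /open_stack rev_iotaS /= (perm_mem (perm_ins _ _ _)) mem_head; congr cons.
apply: eq_in_filter => a; rewrite mem_rev mem_iota => /andP[_ ak].
rewrite (perm_mem (perm_ins _ _ _)) inE xpair_eqE.
by rewrite (ltn_eqF ak).
Qed.

Lemma open_stack_close k L a s : (k < n)%N -> valid n k L -> open_stack n k L = a :: s ->
  open_stack n k.+1 (map (close_block a k) L) = s.
Proof.
move=> kn vL oL; have [aL ak top] := open_stack_top vL oL.
(* Of the open blocks, closing removes exactly [a]. *)
have [L1 LL1 nL1] := perm_block vL aL.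
have mE b : ((b, n) \in map (close_block a k) L) = (b != a) && ((b, n) \in L).
  rewrite (perm_mem (perm_map _ LL1)) /= map_close_id// {1}/close_block eqxx.
  rewrite (perm_mem LL1) !inE !xpair_eqE (gtn_eqF kn) andbF /= eqxx andbT.
  case: eqVneq => [->|//]; apply/negbTE/negP => /(allP nL1).
  by rewrite eqxx.
rewrite /open_stack rev_iotaS /= mE ifF; last first.
  by apply/negbTE/nandP; right; apply/negP => /(valid_lt vL); rewrite ltnn.
under eq_filter do rewrite mE.
rewrite filter_predI -/(open_stack n k L) oL /= eqxx /=.
have : uniq (open_stack n k L) by rewrite filter_uniq// rev_uniq iota_uniq.
rewrite oL /= => /andP[as' _]; apply/all_filterP/allP => b bs.
by apply: contra as' => /eqP <-.
Qed.

End stack.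

Section expansion.
Variable R : realType.
Local Notation RR := (measurableTypeR R).
Local Notation mu := (mu_half R).
Variables p q : R.
Hypotheses (p0 : 0 <= p) (q0 : 0 <= q).

Definition w_head (x : seq R) : R := if x is s :: t :: _ then w p q s t else 1.

Lemma sqr_sqrt_w x : sqrt_w p q x ^+ 2 = w_head x.
Proof.
case: x => [|s [|t x]] /=; rewrite ?expr1n// sqr_sqrtr// /w.
by case: ifP => // _; case: ifP.
Qed.

Lemma w_head_ge0 x : 0 <= w_head x.
Proof. by rewrite -sqr_sqrt_w sqr_ge0. Qed.

Lemma tonelli_w : tonelli (fun x => (w_head x)%:E).
Proof.
split => [x|m]; first by rewrite lee_fin w_head_ge0.
apply/measurable_EFinP; under eq_fun do rewrite -sqr_sqrt_w.
by apply: measurable_funX; exact: measurable_sqrt_w.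
Qed.

(** The stack recursion; [t] lists the values of the open variables, top first. *)
Fixpoint moment (ws : seq (R -> R)) (t : seq R) : \bar R :=
  if ws is f :: ws' then
    (\int[mu]_s ((f s)%:E * ((w_head (s :: t))%:E * moment ws' (s :: t))) +
     if t is s :: t' then (f s)%:E * moment ws' t' else 0)%E
  else (t == [::])%:R%:E.

Lemma moment_cons f ws t : moment (f :: ws) t =
  (\int[mu]_s ((f s)%:E * ((w_head (s :: t))%:E * moment ws (s :: t))) +
   if t is s :: t' then (f s)%:E * moment ws t' else 0)%E.
Proof. by []. Qed.

Lemma tonelli_head (f : R -> R) : good_fun f -> tonelli (fun x => (f (head 0 x))%:E).
Proof.
move=> [f0 mf]; split => [x|m]; first by rewrite lee_fin.
apply/measurable_EFinP; apply: (measurableT_comp mf).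
by under eq_fun do rewrite -nth0; exact: (seq_measurable_id R m).2.
Qed.

Lemma tonelli_behead K : tonelli K -> tonelli (fun x : seq R => K (behead x)).
Proof.
move=> tK; apply: (@tonelli_shift R K behead) => // m.
under eq_fun do rewrite -drop1.
exact: (seq_measurable_drop 1 (seq_measurable_id R m)).
Qed.

Lemma tonelliD K K' : tonelli K -> tonelli K' -> tonelli (fun x : seq R => K x + K' x)%E.
Proof.
move=> [K0 mK] [K0' mK']; split => [x|m]; first exact: adde_ge0.
exact: emeasurable_funD (mK m) (mK' m).
Qed.

Lemma measurable_size (P : pred nat) m :
  measurable_fun setT (fun t : m.-tuple RR => P (size t)).
Proof. by under eq_fun do rewrite size_tuple; exact: measurable_cst. Qed.

Lemma tonelli_moment (ws : seq (R -> R)) : (forall f, List.In f ws -> good_fun f) ->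
  tonelli (moment ws).
Proof.
elim: ws => [_|f ws IH gf].
  split => [x|m]; first by rewrite lee_fin /=; case: eqP.
  rewrite (_ : (fun _ => _) = fun=> (m == 0%N)%:R%:E); first exact: measurable_cst.
  by apply/funext => t; rewrite /= -size_eq0 size_tuple.
have {}IH : tonelli (moment ws) by apply: IH => g gw; apply: gf; right.
have tf := tonelli_head (gf _ (or_introl erefl)).
apply: tonelliD.
  apply: (@tonelli_int R (fun s t => (f s)%:E * ((w_head (s :: t))%:E * moment ws (s :: t)))%E).
  exact: tonelliM tf (tonelliM (tonelli_eta tonelli_w) (tonelli_eta IH)).
rewrite (_ : (fun _ => _) = fun x => if (0 < size x)%N then
   ((f (head 0 x))%:E * moment ws (behead x))%E else 0%E); last by apply/funext => -[].
apply: tonelli_if; first exact: (measurable_size (fun k => 0 < k)%N).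
by apply: tonelliM => //; exact: tonelli_behead.
Qed.

Variables (n : nat) (F : nat -> R -> R).
Hypothesis gF : forall i, good_fun (F i).
Hypothesis F_n : forall s, F n s = 1.

(** An open block has closing time [n], and [F n] is the constant [1]: only the
opening letter counts until the block is closed. *)
Definition block_fun (B : nat * nat) s := F B.1 s * F B.2 s.

Let block_fun0 B s : 0 <= block_fun B s.
Proof. by rewrite mulr_ge0// (gF _).1. Qed.
Let mblock_fun B : measurable_fun [set: RR] (block_fun B : RR -> RR).
Proof. by apply: measurable_funM; exact: (gF _).2. Qed.

(** The values of the open variables when [x] lists the values of all blocks in
their order. *)
Definition stack_vals k L (x : seq R) := [seq nth 0 x (index (a, n) L) | a <- open_stack n k L].

Definition remaining_letters k := [seq F i | i <- iota k (n - k)].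

(** What remains to be integrated at a state: the letters already read and the
rest of the word. *)
Definition state_term k L (x : seq R) : \bar R :=
  if increasing x then ((prod_along block_fun L x)%:E * moment (remaining_letters k)
    (stack_vals k L x))%E else 0%E.

Lemma remaining_lettersS k : (k < n)%N -> remaining_letters k = F k :: remaining_letters k.+1.
Proof. by move=> kn; rewrite /remaining_letters subnS; case: (n - k)%N (subn_gt0 k n) =>
  [|m]; rewrite kn. Qed.

Lemma tonelli_remaining_letters k : tonelli (moment (remaining_letters k)).
Proof.
apply: tonelli_moment => f; rewrite /remaining_letters; elim: (iota _ _) => [//|i s IH] /=
  [<-|//].
exact: gF.
Qed.

Lemma seq_measurable_stack_vals k L m : seq_measurable (fun t : m.-tuple RR =>
  stack_vals k L t).
Proof. exact: (seq_measurable_map _ (fun a => index (a, n) L) (seq_measurable_id R m)). Qed.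

Lemma tonelli_state_term k L : tonelli (state_term k L).
Proof.
apply: tonelli_if; first exact: measurable_increasing.
apply: tonelliM; first exact: tonelli_prod_along.
apply: (@tonelli_shift R (moment (remaining_letters k)) (stack_vals k L));
  last exact: tonelli_remaining_letters.
exact: seq_measurable_stack_vals.
Qed.

Lemma nth_rem (x : seq R) j i : (j <= size x)%N ->
  nth 0 (rem_nth j x) i = nth 0 x (if (i < j)%N then i else i.+1).
Proof.
move=> jx; rewrite /rem_nth nth_cat size_takel//; case: ltnP => ij.
  by rewrite nth_take.
by rewrite nth_drop; congr nth; lia.
Qed.

Lemma stack_vals_ins k L j y : (j <= size L)%N -> size y = (size L).+1 ->
  valid n k L ->
  stack_vals k.+1 (ins j (k, n) L) y = nth 0 y j :: stack_vals k L (rem_nth j y).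
Proof.
move=> jL yL vL; have kL b : (k, b) \notin L.
  by apply/negP => /(valid_lt vL); rewrite ltnn.
rewrite /stack_vals open_stack_ins /= index_ins_new//; congr cons.
apply/eq_in_map => a; rewrite mem_filter => /andP[aL _].
rewrite index_ins//; last by apply: contraTneq aL => <-.
by rewrite nth_rem// yL leqW.
Qed.

(** The parent of the new block is the top of the stack, and inserting the new block
moves the parent one place up exactly when it comes after the new block. *)
Lemma w_head_ins k L j y : (j <= size L)%N -> size y = (size L).+1 ->
  valid n k L -> increasing y ->
  w_head (stack_vals k.+1 (ins j (k, n) L) y) = open_weight n p q k L j.
Proof.
move=> jL yL vL iy; rewrite stack_vals_ins// /open_weight /stack_vals.
case oL : (open_stack n k L) => [//|a s] /=.
have [aL _ _] := open_stack_top vL oL.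
have ai : (index (a, n) L < size L)%N by rewrite index_mem.
rewrite nth_rem ?yL ?leqW//.
move: iy; rewrite /increasing => iy.
have pos i : (i < size y)%N -> 0 < nth 0 y i.
  by move=> iy'; apply: (allP (order_path_min lt_trans iy)); exact: mem_nth.
have lt i i' : (i < i' < size y)%N -> nth 0 y i < nth 0 y i'.
  move=> /andP[ii' i'y].
  have := sorted_ltn_nth lt_trans 0 (path_sorted iy).
  by apply=> //; rewrite inE// (ltn_trans ii').
rewrite /w; case: (ltnP (index (a, n) L) j) => h.
  have l := lt (index (a, n) L) j; rewrite h yL ltnS jL in l.
  have l' := l isT.
  by rewrite (ltNge (nth 0 y j)) (ltW l') andbF l' andbT pos ?yL ?ltnS ?(ltnW ai).
rewrite /=; have -> // : 0 < nth 0 y j < nth 0 y (index (a, n) L).+1.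
by rewrite pos ?lt ?yL ?ltnS ?ai ?h ?jL.
Qed.

Lemma prod_along_close k L a x : valid n k L -> (a, n) \in L -> size x = size L ->
  prod_along block_fun (map (close_block a k) L) x =
    prod_along block_fun L x * F k (nth 0 x (index (a, n) L)).
Proof.
move=> vL aL xL; have [_ + _] := valid_uniq vL.
elim: L aL x xL {vL} => [//|B L IH] aL [//|s x] [xL] /= /andP[BL uL].
rewrite inE in aL; case: (eqVneq B (a, n)) aL BL => [-> _ BL|Ba /=].
  rewrite /close_block eqxx map_close_id.
    by rewrite /block_fun /= F_n mulr1 mulrAC.
  by apply/allP => C CL; apply: contra BL => /eqP/= <-; exact: map_f.
move=> aL BL.
rewrite IH// {1}/close_block ifF ?mulrA//.
by apply/negbTE; apply: contra BL => /eqP ->; exact: (map_f fst aL).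
Qed.

Lemma stack_vals_close k L a s x : (k < n)%N -> valid n k L -> open_stack n k L = a :: s ->
  stack_vals k L x = nth 0 x (index (a, n) L) :: stack_vals k.+1 (map (close_block a k) L) x.
Proof.
move=> kn vL oL; have [aL ak _] := open_stack_top vL oL.
rewrite /stack_vals (open_stack_close kn vL oL) oL /=; congr cons.
have : uniq (open_stack n k L) by rewrite filter_uniq// rev_uniq iota_uniq.
rewrite oL /= => /andP[as' _].
apply/eq_in_map => b bs; congr nth.
have ba : b != a by apply: contraNneq as' => <-.
have bL : (b, n) \in L.
  have : b \in open_stack n k L by rewrite oL inE bs orbT.
  by rewrite mem_filter => /andP[].
by rewrite -(index_map_in (close_inj vL aL) bL) /close_block /= (negPf ba).
Qed.

Lemma iter_intD N K K' : tonelli K -> tonelli K' ->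
  iter_int N (fun x : seq R => K x + K' x)%E = (iter_int N K + iter_int N K')%E.
Proof.
move=> tK tK'; have := @iter_int_sum R N bool [:: true; false] (fun b => if b then K else K').
rewrite big_cons big_seq1 => <-; last by case.
by apply: eq_iter_int => x _; rewrite big_cons big_seq1.
Qed.

(** Reading one letter.  The opening part of the recursion is distributed over the
places of the new block, and the closing part multiplies the factor of the top
block by the letter that closes it. *)
Lemma state_term_step k L : (k < n)%N -> valid n k L ->
  ((partial_weight p q L)%:E * iter_int (size L) (state_term k L) =
   \sum_(L' <- succ_states n k L) (partial_weight p q L')%:E * iter_int (size L') (state_term
     k.+1 L'))%E.
Proof.
move=> kn vL; have wt0 L0 : 0 <= partial_weight p q L0.
  by apply: prodr_ge0 => C _; apply: prodr_ge0 => B _; case: ifP.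
(* [K] is the weight and the continuation of an opening, [pop] the value of a
   closing; [A] and [B] are the two parts of [state_term k L]. *)
pose K s x := ((w_head (s :: stack_vals k L x))%:E * moment (remaining_letters k.+1) (s ::
  stack_vals k L x))%E.
pose pop x := (if stack_vals k L x is s :: t then (F k s)%:E * moment (remaining_letters
  k.+1) t else 0)%E.
have tK : tonelli (fun x => K (head 0 x) (behead x)).
  have tKK : tonelli (fun x => (w_head x)%:E * moment (remaining_letters k.+1) x)%E.
    by apply: tonelliM; [exact: tonelli_w|exact: tonelli_remaining_letters].
  apply: (@tonelli_shift R _ (fun x => head 0 x :: stack_vals k L (behead x)) _ tKK) => m.
  have idm := seq_measurable_id R m.
  apply: seq_measurable_cons; first by under eq_fun do rewrite -nth0; exact: idm.2.
  apply: (seq_measurable_map _ (fun a => index (a, n) L)).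
  by under eq_fun do rewrite -drop1; exact: seq_measurable_drop.
have fBk s : F k s = block_fun (k, n) s by rewrite /block_fun F_n mulr1.
pose A x := (if increasing x then (prod_along block_fun L x)%:E * \int[mu]_s ((block_fun (k,
  n) s)%:E * K s x) else 0)%E.
pose B x := (if increasing x then (prod_along block_fun L x)%:E * pop x else 0)%E.
have tpop : tonelli pop.
  rewrite (_ : pop = fun x => if (0 < size (open_stack n k L))%N then
      ((F k (head 0 (stack_vals k L x)))%:E * moment (remaining_letters k.+1) (behead
        (stack_vals k L x)))%E else 0%E).
    apply: tonelli_if; first by move=> m; exact: measurable_cst.
    apply: tonelliM.
      apply: (@tonelli_shift R (fun x => (F k (head 0 x))%:E) (stack_vals k L));
        first exact: seq_measurable_stack_vals.
      exact: tonelli_head.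
    apply: (@tonelli_shift R (fun x => moment (remaining_letters k.+1) (behead x))
      (stack_vals k L)); first exact: seq_measurable_stack_vals.
    exact/tonelli_behead/tonelli_remaining_letters.
  by apply/funext => x; rewrite /pop /stack_vals; case: (open_stack n k L).
have tA : tonelli A.
  apply: tonelli_if; first exact: measurable_increasing.
  apply: tonelliM; first exact: tonelli_prod_along.
  apply: (@tonelli_int R (fun s x => (block_fun (k, n) s)%:E * K s x)%E).
  apply: tonelliM => //; apply: tonelli_head; by split.
have tB : tonelli B.
  apply: tonelli_if; first exact: measurable_increasing.
  by apply: tonelliM => //; exact: tonelli_prod_along.
rewrite (@eq_iter_int R _ (state_term k L) (fun x => A x + B x)%E); last first.
  move=> x _; rewrite /state_term /A /B; case: (increasing x); last by rewrite adde0.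
  rewrite remaining_lettersS// moment_cons ge0_muleDr.
  - by under eq_integral do rewrite fBk.
  - apply: integral_ge0 => s _; rewrite mule_ge0 ?lee_fin ?(gF _).1//.
    by rewrite mule_ge0 ?lee_fin ?w_head_ge0//; exact: (tonelli_remaining_letters _).1.
  - exact: tpop.1.
rewrite iter_intD// ge0_muleDr; [|exact/iter_int_ge0/tA.1|exact/iter_int_ge0/tB.1].
rewrite big_cat; congr (_ + _)%E.
  rewrite (iter_int_insert block_fun0 mblock_fun)// big_map ge0_sume_distrr; last first.
    move=> j _; apply: iter_int_ge0 => y; case: ifP => // _.
    by rewrite mule_ge0 ?lee_fin ?prod_along_ge0//; exact: (tK.1 (_ :: _)).
  apply: eq_big_seq => j; rewrite mem_iota add0n ltnS => /andP[_ jL].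
  rewrite partial_weight_ins// EFinM -muleA; congr (_ * _)%E; rewrite -iter_intZl; last 2 first.
  - by rewrite lee_fin /open_weight; case: open_stack => // a _; case: ifP.
  - exact: tonelli_state_term.
  rewrite size_ins; apply: eq_iter_int => y yL.
  rewrite /state_term; case: ifP => iy; last by rewrite mule0.
  rewrite muleCA /K -stack_vals_ins//; congr (_ * _)%E.
  by rewrite w_head_ins.
case oL : (open_stack n k L) => [|a s].
  rewrite /= big_nil (@eq_iter_int R _ B (fun=> 0%E)) ?iter_int0 ?mule0// => x _.
  by rewrite /B /pop /stack_vals oL mule0 if_same.
rewrite /= big_seq1 (partial_weight_close p q kn vL oL) size_map; congr (_ * _)%E.
have [aL _ _] := open_stack_top vL oL.
apply: eq_iter_int => x xL; rewrite /B /state_term; case: ifP => // ix.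
by rewrite prod_along_close// /pop (stack_vals_close _ kn vL oL) EFinM muleA.
Qed.

Lemma expansion : moment (remaining_letters 0) [::] =
  (\sum_(L <- states n n) (partial_weight p q L)%:E * iter_int (size L) (state_term n L))%E.
Proof.
suff H k : (k <= n)%N -> moment (remaining_letters 0) [::] =
    (\sum_(L <- states n k) (partial_weight p q L)%:E * iter_int (size L) (state_term k L))%E
      by exact: H.
elim: k => [_|k IH kn].
  rewrite /= big_seq1 /partial_weight big_nil mul1e /= /state_term /increasing /= mul1e.
  by [].
rewrite IH ?(ltnW kn)// [in RHS]/= big_flatten big_map.
apply: eq_big_seq => L; rewrite states_valid ?(ltnW kn)// => vL.
exact: state_term_step.
Qed.

End expansion.

(** * Value of the recursion for indicator functions of intervals *)

Section leaves.
Variables (R : realType) (p q : R).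
Hypotheses (p0 : 0 <= p) (q0 : 0 <= q).
Variables (n : nat) (f : 'I_n -> Theta R).
Variables (r : nat) (I : 'I_r -> set R).
Hypothesis hI_lt : forall i j : 'I_r, (i < j)%N -> set_lt (I i) (I j).
Hypothesis hI_range : range I = range (fun j : 'I_n => supp (f j)).
Local Notation RR := (measurableTypeR R).
Local Notation mu := (mu_half R).

(** The value [1] beyond the word is the one required of an open block. *)
Definition letter (i : nat) : R -> R :=
  if insub i is Some j then chi (f j) else fun=> 1.

Lemma letterE (j : 'I_n) : letter j = chi (f j).
Proof. by rewrite /letter valK. Qed.

Lemma good_letter i : good_fun (letter i).
Proof.
rewrite /letter; case: insub => [j|]; first exact: good_chi.
by split; [|exact: measurable_cst].
Qed.

Definition itv_of c : set R := if insub c is Some i then I i else set0.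

Lemma itv_ofE (i : 'I_r) : itv_of i = I i.
Proof. by rewrite /itv_of valK. Qed.

Lemma I_supp (i : 'I_r) : exists j, I i = supp (f j).
Proof.
have : range I (I i) by exists i.
by rewrite hI_range => -[j _ <-]; exists j.
Qed.

Lemma supp_I (j : 'I_n) : exists i, supp (f j) = I i.
Proof.
have : range (fun j => supp (f j)) (supp (f j)) by exists j.
by rewrite -hI_range => -[i _ <-]; exists i.
Qed.

Lemma itv_lt c c' : (c < c' < r)%N -> set_lt (itv_of c) (itv_of c').
Proof.
move=> /andP[cc' c'r]; have cr := ltn_trans cc' c'r.
rewrite -[c]/(nat_of_ord (Ordinal cr)) -[c']/(nat_of_ord (Ordinal c'r)) !itv_ofE.
exact: hI_lt.
Qed.

Definition interval_index (i : nat) : nat :=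
  if insub i is Some j then xget (0 : nat) [set c | (c < r)%N /\ supp (f j) = itv_of c]
  else 0.

Lemma interval_indexP (j : 'I_n) : (interval_index j < r)%N /\ supp (f j) =
  itv_of (interval_index j).
Proof.
rewrite /interval_index valK; case: xgetP => [c _ //|/(_ _) no].
have [i ji] := supp_I j; exfalso; apply: (no (nat_of_ord i)); split => //.
by rewrite itv_ofE.
Qed.

Lemma itv_neq0 c : (c < r)%N -> itv_of c !=set0.
Proof.
move=> cr; rewrite -[c]/(nat_of_ord (Ordinal cr)) itv_ofE.
by have [j ->] := I_supp (Ordinal cr); exists (val (f j)).1; exact: supp_neq0.
Qed.

(** Between nonempty disjoint intervals the order is the order of the labels; this
turns the condition on supports into sortedness of labels. *)
Lemma itv_le c c' : (c < r)%N -> (c' < r)%N ->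
  set_le (itv_of c) (itv_of c') <-> (c <= c')%N.
Proof.
move=> cr c'r; split; last first.
  rewrite leq_eqVlt => /predU1P[->|cc']; first by right.
  by left; apply: itv_lt; rewrite cc'.
rewrite leqNgt => h; apply/negP => c'c.
have lt : set_lt (itv_of c') (itv_of c) by apply: itv_lt; rewrite c'c.
have [x cx] := itv_neq0 cr; have [y cy] := itv_neq0 c'r.
have yx := lt _ _ cy cx; case: h => [/(_ _ _ cx cy)|E].
  by rewrite ltNge (ltW yx).
by have := lt y y cy; rewrite E ltxx => /(_ cy).
Qed.

Lemma itv_inj c c' : (c < r)%N -> (c' < r)%N -> itv_of c = itv_of c' -> c = c'.
Proof.
move=> cr c'r E; apply/eqP; rewrite eqn_leq.
by apply/andP; split; apply/itv_le => //; right.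
Qed.

Let len c : R := fine (lebesgue_measure (itv_of c)).

Lemma measurable_itv_of c : measurable (itv_of c : set RR).
Proof.
rewrite /itv_of; case: insub => [i|//]; have [j ->] := I_supp i.
exact: measurable_supp.
Qed.

Lemma mu_itv_of c : (c < r)%N -> mu (itv_of c) = (len c)%:E.
Proof.
move=> cr; rewrite /len -[c]/(nat_of_ord (Ordinal cr)) itv_ofE.
by have [j ->] := I_supp (Ordinal cr); exact: mu_supp.
Qed.

Section leaf.
Variable L : seq (nat * nat).
Hypotheses (vL : valid n n L) (cL : all (chord n) L).

Lemma chord_interval_index B : B \in L ->
  (interval_index B.1 < r)%N /\ (interval_index B.2 < r)%N.
Proof.
move=> /(allP cL)/andP[B12 Bn]; have B1n := ltn_trans B12 Bn.
by have [? _] := interval_indexP (Ordinal B1n); have [? _] := interval_indexP (Ordinal Bn).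
Qed.

Definition interval_indices := [seq interval_index B.1 | B <- L].

(** The first condition of [adapted]. *)
Definition matched := all (fun B => interval_index B.1 == interval_index B.2) L.

Lemma interval_indices_lt : all (fun c => c < r)%N interval_indices.
Proof. by apply/allP => c /mapP[B /chord_interval_index[? _] ->]. Qed.

Lemma letter_interval_index i : (i < n)%N -> letter i = \1_(itv_of (interval_index i)).
Proof.
move=> ii; rewrite -[i in LHS]/(nat_of_ord (Ordinal ii)) letterE /chi.
by have [_ ->] := interval_indexP (Ordinal ii).
Qed.

(** Distinct intervals are disjoint, so that a badly matched block kills the
integrand. *)
Lemma block_fun_chord B s : B \in L ->
  block_fun letter B s = if interval_index B.1 ==
    interval_index B.2 then \1_(itv_of (interval_index B.1)) s else 0.
Proof.
move=> BL; have /andP[B12 Bn] := allP cL _ BL.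
have [l1 l2] := chord_interval_index BL.
rewrite /block_fun !letter_interval_index ?(ltn_trans B12)//; case: eqP => [<-|/eqP ne].
  by rewrite !indicE; case: (_ \in _); rewrite ?mulr1 ?mulr0.
rewrite !indicE; case: (boolP (s \in itv_of (interval_index B.1))); rewrite ?mul0r// inE => s1.
case: (boolP (s \in itv_of (interval_index B.2))); rewrite ?mulr0// inE => s2.
move: ne; rewrite neq_ltn => /orP[h|h].
  by have := itv_lt (c := interval_index B.1) (c' := interval_index B.2); rewrite h l2 =>
    /(_ isT _ _ s1 s2); rewrite ltxx.
by have := itv_lt (c := interval_index B.2) (c' := interval_index B.1); rewrite h l1 =>
  /(_ isT _ _ s2 s1); rewrite ltxx.
Qed.

Lemma prod_along_matched x : size x = size L ->
  prod_along (block_fun letter) L x = if matched then prod_along (fun c =>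
    \1_(itv_of c)) interval_indices x else 0.
Proof.
suff H L' : {subset L' <= L} -> forall x, size x = size L' ->
  prod_along (block_fun letter) L' x =
    if all (fun B => interval_index B.1 == interval_index B.2) L' then
      prod_along (fun c => \1_(itv_of c)) [seq interval_index B.1 | B <- L'] x else 0 by
        exact: H.
elim: L' => [_ [|]//|B L' IH sL [|s {}x]// [xL]] /=.
rewrite block_fun_chord ?sL ?mem_head// IH//; last by move=> C CL; apply: sL;
  rewrite inE CL orbT.
by case: eqP => _; rewrite ?mul0r//=; case: ifP; rewrite ?mulr0.
Qed.

Lemma adapted_chords : adapted f (map (chord_set n) L) <->
  matched && sorted leq interval_indices.
Proof.
have ord i : (i < n)%N -> exists j : 'I_n, val j = i by move=> h; exists (Ordinal h).
have chiE (i j : 'I_n) : chi (f i) = chi (f j) <-> interval_index i = interval_index j.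
  have [li si] := interval_indexP i; have [lj sj] := interval_indexP j; split => [E|E];
    last first.
    by rewrite /chi si sj E.
  apply: itv_inj => //; rewrite -si -sj; apply/seteqP; split => x fx; apply: contrapT => nfx.
    have := congr1 (fun g => g x) E; rewrite /chi !indicE mem_set// memNset//.
    by move/eqP; rewrite oner_eq0.
  have := congr1 (fun g => g x) E; rewrite /chi !indicE memNset// mem_set//.
  by move/eqP; rewrite eq_sym oner_eq0.
split.
  move=> [ad1 ad2].
  have mt : matched.
    apply/allP => B BL; have /andP[B12 Bn] := allP cL _ BL.
    have [i iB] := ord _ (ltn_trans B12 Bn); have [j jB] := ord _ Bn.
    rewrite -iB -jB; apply/eqP/chiE; apply: (ad1 (chord_set n B)); first exact: map_f.
    - by rewrite in_chord_set -iB eqxx.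
    - by rewrite in_chord_set -jB eqxx orbT.
  rewrite mt /=; apply/(sortedP 0%N) => k; rewrite size_map => kL.
  have kL' := ltnW kL.
  rewrite !(nth_map (0,0)%N)//.
  have BL := mem_nth (0,0)%N kL'; have CL := mem_nth (0,0)%N kL.
  have /andP[B12 Bn] := allP cL _ BL; have /andP[C12 Cn] := allP cL _ CL.
  have [i iB] := ord _ (ltn_trans B12 Bn); have [j jC] := ord _ (ltn_trans C12 Cn).
  rewrite -iB -jC; have [li si] := interval_indexP i; have [lj sj] := interval_indexP j.
  apply/(itv_le li lj); rewrite -si -sj.
  apply: (ad2 k k.+1); first by rewrite ltnSn size_map.
  - by rewrite (nth_map (0,0)%N)// in_chord_set -iB eqxx.
  - by rewrite (nth_map (0,0)%N)// in_chord_set -jC eqxx.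
move=> /andP[/allP mt sl].
have lab B (i : 'I_n) : B \in L -> i \in chord_set n B -> interval_index i = interval_index B.1.
  by move=> BL; rewrite in_chord_set => /orP[]/eqP->//; apply/esym/eqP/mt.
split.
  move=> A i j /mapP[B BL ->] iB jB; apply/chiE.
  by rewrite (lab B)// (lab B).
move=> k l i j /andP[kl]; rewrite size_map => lL.
have kL := ltn_trans kl lL.
rewrite !(nth_map (0,0)%N)// => ik jl.
have [li si] := interval_indexP i; have [lj sj] := interval_indexP j.
rewrite si sj; apply/(itv_le li lj).
rewrite (lab _ i (mem_nth _ kL) ik) (lab _ j (mem_nth _ lL) jl).
rewrite -!(nth_map _ 0%N (fun B => interval_index B.1))//.
apply: (sorted_leq_nth leq_trans leqnn); rewrite ?inE ?size_map//; exact: ltnW.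
Qed.

(** Each matched block uses its interval twice. *)
Lemma count_interval_indices (i : 'I_r) : matched ->
  (#|[pred j : 'I_n | `[< supp (f j) = I i >] ]|./2)%N =
    count_mem (nat_of_ord i) interval_indices.
Proof.
move=> /allP mt; rewrite -[RHS]doubleK; congr half.
have -> : #|[pred j : 'I_n | `[< supp (f j) = I i >] ]| =
    count (fun j => interval_index j == i) (iota 0 n).
  rewrite -val_enum_ord -sum1_card -sum1_count big_map big_enum_cond /=.
  apply: eq_bigl => j; rewrite inE /=; have [lj sj] := interval_indexP j.
  apply/asboolP/eqP => [E|E]; last by rewrite sj E itv_ofE.
  by apply: (itv_inj lj (ltn_ord i)); rewrite -sj itv_ofE.
have /and3P[_ e _] := vL; rewrite -(permP e) (endpoints_chords cL) count_cat.
rewrite /interval_indices count_map -addnn !count_map; congr (_ + _)%N.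
by apply: eq_in_count => B BL /=; rewrite (eqP (mt _ BL)).
Qed.

Lemma iter_int_leaf : iter_int (size L) (state_term p q n letter n L) =
  (if `[< adapted f (map (chord_set n) L) >] then
    \prod_(i < r) (fine (lebesgue_measure (I i)) ^+
      (#|[pred j : 'I_n | `[< supp (f j) = I i >] ]|./2) /
      (#|[pred j : 'I_n | `[< supp (f j) = I i >] ]|./2)`!%:R) else 0)%:E.
Proof.
have E : iter_int (size L) (state_term p q n letter n L) =
    if matched then simplex_vol itv_of interval_indices else 0%E.
  transitivity (iter_int (size L) (fun x =>
    if increasing x then (prod_along (block_fun letter) L x)%:E else 0%E)).
    apply: eq_iter_int => x _; rewrite /state_term; case: ifP => // _.
    rewrite /remaining_letters subnn /= /stack_vals.
    rewrite (_ : open_stack n n L = [::]) ?mule1//.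
    apply/eqP; rewrite -[_ == _]negbK -has_filter; apply/hasPn => a _.
    by apply/negP => /(allP cL); rewrite /chord /= ltnn andbF.
  rewrite (@eq_iter_int R _ _ (fun x => if increasing x then
     (if matched then prod_along (fun c =>
       \1_(itv_of c)) interval_indices x else 0)%:E else 0%E)).
    rewrite /simplex_vol size_map; case: matched => //.
    by rewrite -[RHS](iter_int0 R (size L)); apply: eq_iter_int => x _; case: ifP.
  by move=> x xL; rewrite prod_along_matched.
rewrite E; have ad := adapted_chords.
case: asboolP => [/ad/andP[mt sl]|nad].
  rewrite mt (simplex_vol_sorted measurable_itv_of itv_lt mu_itv_of interval_indices_lt sl).
  by congr EFin; apply: eq_bigr => i _; rewrite /len itv_ofE count_interval_indices.
case: ifP => // mt; apply: (simplex_vol_unsorted itv_lt interval_indices_lt).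
by apply/negP => sl; apply: nad; apply/ad; rewrite mt.
Qed.

End leaf.

Theorem word_value : moment p q (remaining_letters n letter 0) [::] =
  (\prod_(i < r) (fine (lebesgue_measure (I i)) ^+
      (#|[pred j : 'I_n | `[< supp (f j) = I i >] ]|./2) /
      (#|[pred j : 'I_n | `[< supp (f j) = I i >] ]|./2)`!%:R) *
   \sum_(P : n.-bseq {set 'I_n} | ONC2 P && `[< adapted f P >]) weight p q P)%:E.
Proof.
rewrite (expansion p0 q0 good_letter); last first.
  by move=> s; rewrite /letter; case: insubP => // j; rewrite ltnn.
rewrite (sum_ONC2 (weight p q) (fun P => `[< adapted f P >])).
rewrite mulr_sumr -sumEFin [RHS]big_mkcond /=; apply: eq_big_seq => L.
rewrite states_valid// => vL.
have [cL|ncL] /= := boolP (all (chord n) L).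
  rewrite iter_int_leaf// -EFinM; case: asboolP => _; last by rewrite mulr0.
  by rewrite weight_chords// mulrC.
rewrite (@eq_iter_int R _ _ (fun=> 0%E)) ?iter_int0 ?mule0// => x _.
rewrite /state_term /remaining_letters subnn /stack_vals; case: ifP => // _ /=.
have : open_stack n n L != [::].
  move/allPn : ncL => [[a b] BL]; have /and3P[/allP/(_ _ BL) /andP[/= an h] _ _] := vL.
  rewrite /chord /=; case/orP: h => [/eqP bn|->//] _; subst b.
  by rewrite -has_filter; apply/hasP; exists a => //; rewrite mem_rev mem_iota.
by case: open_stack => // *; rewrite mule0.
Qed.
End leaves.

(** * Bounded integral operators and their adjoints *)

Section square_integrable.
Context d (T : measurableType d) (R : realType) (nu : {measure set T -> \bar R}).
Implicit Types u v : T -> R.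

(** Real square-integrable functions.  All kernels below are real, so the real and
imaginary parts of a vector never mix. *)
Definition sqint_fun u := measurable_fun [set: T] u /\
  (\int[nu]_x ((u x) ^+ 2)%:E < +oo)%E.

Lemma sqr_measurable u : measurable_fun [set: T] u ->
  measurable_fun [set: T] (fun x => ((u x) ^+ 2)%:E).
Proof. by move=> mu; apply/measurable_EFinP; exact: measurable_funX. Qed.

Lemma norm_mul_le (a b : R) : `|a * b| <= a ^+ 2 + b ^+ 2.
Proof.
rewrite normrM -[a ^+ 2]real_normK ?num_real// -[b ^+ 2]real_normK ?num_real//.
have := normr_ge0 a; have := normr_ge0 b; nra.
Qed.

Lemma sqr_integrable u : sqint_fun u -> nu.-integrable setT (fun x => ((u x) ^+ 2)%:E).
Proof.
move=> [mu uoo]; apply/integrableP; split; first exact: sqr_measurable.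
by under eq_integral do rewrite gee0_abs ?lee_fin ?sqr_ge0//.
Qed.

Lemma mul_integrable u v : sqint_fun u -> sqint_fun v ->
  nu.-integrable setT (fun x => (u x * v x)%:E).
Proof.
move=> su sv.
apply: (le_integrable measurableT (g := fun x => ((u x) ^+ 2)%:E + ((v x) ^+ 2)%:E)%E).
- by apply/measurable_EFinP; apply: measurable_funM; [exact: su.1|exact: sv.1].
- move=> x _; rewrite -EFinD !abse_EFin lee_fin.
  by rewrite [leRHS]ger0_norm ?norm_mul_le// addr_ge0 ?sqr_ge0.
- exact: (integrableD measurableT (sqr_integrable su) (sqr_integrable sv)).
Qed.

End square_integrable.

Section kernel_operator.
Context d1 d2 (T1 : measurableType d1) (T2 : measurableType d2) (R : realType).
Variables (m1 : {sigma_finite_measure set T1 -> \bar R}).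
Variables (m2 : {sigma_finite_measure set T2 -> \bar R}).
Variables (k : T1 * T2 -> R) (K : R).
Hypotheses (mk : measurable_fun setT k) (K0 : 0 < K).
Hypothesis kK : forall t, (\int[m1]_s ((k (s, t)) ^+ 2)%:E <= K%:E)%E.

(** Integrating out the first variable against a kernel with uniformly bounded
square norm in that variable. *)
Definition kernel_op (v : T1 * T2 -> R) (t : T2) : R := \int[m1]_s (k (s, t) * v (s, t)).

Lemma measurable_section1 (v : T1 * T2 -> R) t : measurable_fun setT v ->
  measurable_fun setT (fun s => v (s, t)).
Proof. by move=> mv; apply: (measurableT_comp mv); exact: measurable_pair2. Qed.

Variable v : T1 * T2 -> R.
Hypothesis sv : sqint_fun (m1 \x m2)%E v.

Lemma measurable_kernel_op : measurable_fun setT (kernel_op v).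
Proof.
have mfine := @fine_measurable R setT measurableT; apply: (measurableT_comp mfine).
pose kv z : \bar R := (k z * v z)%:E.
have mkv : measurable_fun setT kv.
  by apply/measurable_EFinP; apply: measurable_funM => //; exact: sv.1.
rewrite (_ : (fun _ => _) = (fun t => fubini_G m1 kv^\+ t - fubini_G m1 kv^\- t)%E).
  apply: emeasurable_funB; apply: measurable_fun_fubini_tonelli_G => //.
  - exact: measurable_funepos.
  - exact: measurable_funeneg.
apply/funext => t; rewrite integralE; congr (_ - _)%E; apply: eq_integral => s _.
  by rewrite !funeposE.
by rewrite !funenegE.
Qed.

Definition good_section t := (\int[m1]_s ((v (s, t)) ^+ 2)%:E < +oo)%E.

Lemma ae_good_section : {ae m2, forall t, good_section t}.
Proof.
have tv : (\int[m2]_t \int[m1]_s ((v (s, t)) ^+ 2)%:E < +oo)%E.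
  apply: le_lt_trans sv.2.
  by rewrite fubini_tonelli2//; [exact: (sqr_measurable sv.1)|by move=> z;
    rewrite lee_fin sqr_ge0].
have i2 : m2.-integrable setT (fun t => \int[m1]_s ((v (s, t)) ^+ 2)%:E)%E.
  apply/integrableP; split.
    apply: (measurable_fun_fubini_tonelli_G (fun z => ((v z) ^+ 2)%:E)).
      exact: (sqr_measurable sv.1).
    by move=> z; rewrite lee_fin sqr_ge0.
  apply: le_lt_trans tv; rewrite le_eqVlt; apply/orP; left; apply/eqP; apply: eq_integral =>
    t _.
  by rewrite gee0_abs// integral_ge0// => s _; rewrite lee_fin sqr_ge0.
have := integrable_ae measurableT i2; apply: filterS.
move=> t /(_ Logic.I) h; rewrite /good_section -ge0_fin_numE//.
by apply: integral_ge0 => s _; rewrite lee_fin sqr_ge0.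
Qed.

Lemma k_sqint t : sqint_fun m1 (fun s => k (s, t)).
Proof. split; [exact: measurable_section1|exact: le_lt_trans (kK t) (ltry _)]. Qed.

Lemma v_sqint t : good_section t -> sqint_fun m1 (fun s => v (s, t)).
Proof. by move=> g; split; [exact: (measurable_section1 t sv.1)|]. Qed.

(** Cauchy-Schwarz in the first variable, at every point: if the right-hand side is
infinite there is nothing to prove. *)
Lemma kernel_op_sqr_le t : (((kernel_op v t) ^+ 2)%:E <=
  K%:E * \int[m1]_s ((v (s, t)) ^+ 2)%:E)%E.
Proof.
have [g|] := boolP `[< good_section t >]; last first.
  move=> /asboolPn; rewrite /good_section => /negP; rewrite -leNgt leye_eq => /eqP ->.
  by rewrite gt0_muley ?lte_fin// leey.
move: g => /asboolP g.
have kt := k_sqint t; have vt := v_sqint g.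
have ikv := mul_integrable kt vt; have ik := sqr_integrable kt; have iv := sqr_integrable vt.
(* The integral of [(v - c * k) ^ 2] is nonnegative for every [c]; the choice
   [c = X / K] gives [X ^ 2 <= K * V]. *)
pose X := kernel_op v t; pose c := X / K.
pose V := \int[m1]_s ((v (s, t)) ^+ 2); pose Q := \int[m1]_s ((k (s, t)) ^+ 2).
have VE : (\int[m1]_s ((v (s, t)) ^+ 2)%:E = V%:E)%E by rewrite fineK// integrable_fin_num.
have QK : Q <= K.
  by rewrite -lee_fin fineK ?integrable_fin_num.
have h : 0 <= V - 2 * c * X + c ^+ 2 * Q.
  rewrite /V /Q /X /kernel_op -!RintegralZl// -RintegralB//; last first.
    by have := integrableZl measurableT (2 * c) ikv.
  rewrite -RintegralD//; last 2 first.
  - by have := integrableB measurableT iv (integrableZl measurableT (2 * c) ikv).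
  - by have := integrableZl measurableT (c ^+ 2) ik.
  apply: Rintegral_ge0 => s _.
  rewrite [leRHS](_ : _ = (v (s, t) - c * k (s, t)) ^+ 2) ?sqr_ge0//; ring.
rewrite VE -EFinM lee_fin.
have hc : c * K = X by rewrite /c divfK// gt_eqF.
have cQ : c ^+ 2 * Q <= c ^+ 2 * K by rewrite ler_wpM2l ?sqr_ge0.
have : 0 <= V - c * X.
  rewrite -hc; have := h; rewrite -hc; move: cQ; nra.
rewrite -/X -[in X in X ^+ 2]hc => h2.
have := mulr_ge0 (ltW K0) h2; rewrite -hc; nra.
Qed.

Lemma kernel_op_sqint : (\int[m2]_t ((kernel_op v t) ^+ 2)%:E <=
  K%:E * \int[m1 \x m2]_z ((v z) ^+ 2)%:E)%E.
Proof.
have m2v : measurable_fun setT (fun z => ((v z) ^+ 2)%:E) by exact: (sqr_measurable sv.1).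
have v20 z : (0 <= ((v z) ^+ 2)%:E)%E by rewrite lee_fin sqr_ge0.
rewrite fubini_tonelli2// -ge0_integralZl_EFin ?(ltW K0)//; last 2 first.
- by move=> t _; exact: integral_ge0.
- exact: measurable_fun_fubini_tonelli_G.
apply: ge0_le_integral => //.
- by move=> t _; rewrite lee_fin sqr_ge0.
- exact: sqr_measurable measurable_kernel_op.
- by apply: measurable_funeM; exact: measurable_fun_fubini_tonelli_G.
- by move=> t _; exact: kernel_op_sqr_le.
Qed.

Variable u : T2 -> R.
Hypothesis su : sqint_fun m2 u.

(** Fubini's theorem.  The inner integral defining [kernel_op] makes sense for
almost every [t] only, which is enough. *)
Lemma kernel_op_adjoint : (\int[m1 \x m2]_z (k z * u z.2 * v z)%:E =
  \int[m2]_t (u t * kernel_op v t)%:E)%E.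
Proof.
have mu2 : measurable_fun setT (fun z : T1 * T2 => u z.2).
  exact: (measurableT_comp su.1 measurable_snd).
have sku : sqint_fun (m1 \x m2)%E (fun z => k z * u z.2).
  split; first exact: measurable_funM.
  rewrite fubini_tonelli2; last 2 first.
  - by apply: sqr_measurable; exact: measurable_funM.
  - by move=> z; rewrite lee_fin sqr_ge0.
  apply: (@le_lt_trans _ _ (\int[m2]_t (K%:E * ((u t) ^+ 2)%:E))%E); last first.
    rewrite ge0_integralZl_EFin ?(ltW K0)//; last 2 first.
    - by move=> t _; rewrite lee_fin sqr_ge0.
    - exact: sqr_measurable su.1.
    by rewrite lte_mul_pinfty ?lee_fin ?(ltW K0)//; exact: su.2.
  apply: ge0_le_integral => //.
  - by move=> t _; apply: integral_ge0 => s _; rewrite lee_fin sqr_ge0.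
  - apply: measurable_fun_fubini_tonelli_G; last by move=> z; rewrite lee_fin sqr_ge0.
    by apply: sqr_measurable; exact: measurable_funM.
  - by apply: measurable_funeM; exact: sqr_measurable su.1.
  move=> t _; rewrite /fubini_G.
  under eq_integral do rewrite /= exprMn mulrC EFinM.
  rewrite ge0_integralZl_EFin ?sqr_ge0//; last 2 first.
  - by move=> s _; rewrite lee_fin sqr_ge0.
  - by apply: sqr_measurable; exact: measurable_section1.
  by rewrite muleC lee_wpmul2r// lee_fin sqr_ge0.
have ikuv := mul_integrable sku sv.
rewrite -integral21_prod_meas1//.
have mG : measurable_fun setT (fubini_G m1 (fun z => (k z * u z.2 * v z)%:E)).
  exact: (measurable_fubini_G ikuv).
apply: ae_eq_integral => //.
  by apply/measurable_EFinP; apply: measurable_funM; [exact: su.1|exact: measurable_kernel_op].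
have := ae_good_section; apply: filterS.
move=> t g _ /=; rewrite /fubini_G.
have ikv := mul_integrable (k_sqint t) (v_sqint g).
under eq_integral do rewrite /= -mulrA mulrCA EFinM.
by rewrite integralZl// EFinM /kernel_op /Rintegral fineK ?integrable_fin_num.
Qed.

End kernel_operator.

(** * The inner product of the Fock space through real components *)

Section fock_forms.
Variables (R : realType) (p q : R).
Local Notation RR := (measurableTypeR R).
Local Notation mu := (mu_half R).
Local Notation fields := (forall n, n.-tuple RR -> R).
Implicit Types (u v : fields) (f : Theta R) (F G H : fock_fun R).

(** Real components of vectors of the Fock space. *)
Definition square_summable u := (forall n, measurable_fun setT (u n)) /\
  (\sum_(0 <= n <oo) \int[mu_tuple R n]_x ((u n x) ^+ 2)%:E < +oo)%E.

Lemma sqr_int_ge0 u n : (0 <= \int[mu_tuple R n]_x ((u n x) ^+ 2)%:E)%E.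
Proof. by apply: integral_ge0 => x _; rewrite lee_fin sqr_ge0. Qed.

Lemma square_summable_sqint u n : square_summable u -> sqint_fun (mu_tuple R n) (u n).
Proof.
move=> [mu_ fu]; split; [exact: mu_|apply: le_lt_trans fu].
apply: (@le_trans _ _ (\sum_(0 <= i < n.+1) \int[mu_tuple R i]_x ((u i x) ^+ 2)%:E)%E).
  by rewrite big_nat_recr//= leeDr// sume_ge0// => i _; exact: sqr_int_ge0.
by apply: nneseries_lim_ge => i _ _; exact: sqr_int_ge0.
Qed.

Definition pairing u v : R :=
  limn (series (fun n => \int[mu_tuple R n]_x (u n x * v n x))).

Lemma pairingC u v : pairing u v = pairing v u.
Proof.
rewrite /pairing; congr (limn (series _)); apply/funext => n.
by apply: eq_Rintegral => x _; rewrite mulrC.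
Qed.

Lemma pairing_integrable u v n : square_summable u -> square_summable v ->
  (mu_tuple R n).-integrable setT (fun x => (u n x * v n x)%:E).
Proof. by move=> su sv; apply: mul_integrable; exact: square_summable_sqint. Qed.

(** Absolute convergence from [|a b| <= a ^ 2 + b ^ 2]. *)
Lemma pairing_cvg u v : square_summable u -> square_summable v ->
  cvgn (series (fun n => \int[mu_tuple R n]_x (u n x * v n x))).
Proof.
move=> su sv; apply: normed_cvg; apply: nnseries_is_cvg => [i|]; first exact: normr_ge0.
apply: (@le_lt_trans _ _ (\sum_(0 <= n <oo) (\int[mu_tuple R n]_x ((u n x) ^+ 2)%:E +
   \int[mu_tuple R n]_x ((v n x) ^+ 2)%:E))%E).
  apply: lee_nneseries => [n _ _|n _]; first by rewrite lee_fin; exact: normr_ge0.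
  have iuv := pairing_integrable n su sv.
  have u2 := square_summable_sqint n su; have v2 := square_summable_sqint n sv.
  rewrite -ge0_integralD//; last 4 first.
  - by move=> x _; rewrite lee_fin sqr_ge0.
  - exact: sqr_measurable u2.1.
  - by move=> x _; rewrite lee_fin sqr_ge0.
  - exact: sqr_measurable v2.1.
  apply: (@le_trans _ _ (\int[mu_tuple R n]_x `|(u n x * v n x)%:E|)%E).
    by rewrite EFin_normr_Rintegral//; apply: le_abse_integral => //; exact: measurable_int iuv.
  apply: ge0_le_integral => //.
  - by apply: measurableT_comp => //; exact: measurable_int iuv.
  - by apply: emeasurable_funD; apply: sqr_measurable; [exact: u2.1|exact: v2.1].
  - by move=> x _; rewrite -EFinD abse_EFin lee_fin norm_mul_le.
rewrite nneseriesD; [|by move=> n _ _; exact: sqr_int_ge0..].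
by rewrite lte_add_pinfty//; [exact: su.2|exact: sv.2].
Qed.

Definition addf u v : fields := fun n x => u n x + v n x.

Lemma pairingDl u u' v : square_summable u -> square_summable u' -> square_summable v ->
  pairing (addf u u') v = pairing u v + pairing u' v.
Proof.
move=> su su' sv; rewrite /pairing -lim_seriesD; [|exact: pairing_cvg..].
congr (limn (series _)); apply/funext => n.
rewrite /= -[RHS]RintegralD//; [|exact: pairing_integrable..].
by apply: eq_Rintegral => x _; rewrite mulrDl.
Qed.

Definition ae_same u u' := forall n, {ae mu_tuple R n, forall x, u n x = u' n x}.

Lemma pairing_ae u u' v : square_summable u -> square_summable u' -> square_summable v ->
  ae_same u u' -> pairing u v = pairing u' v.
Proof.
move=> su su' sv uu'; rewrite /pairing; congr (limn (series _)); apply/funext => n.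
rewrite /Rintegral; congr fine; apply: ae_eq_integral => //.
- exact: measurable_int (pairing_integrable n su sv).
- exact: measurable_int (pairing_integrable n su' sv).
- by have := uu' n; apply: filterS => x /= -> _.
Qed.

Lemma integral_tcons n (g : n.+1.-tuple RR -> R) :
  (mu_tuple R n.+1).-integrable setT (fun x => (g x)%:E) ->
  (\int[mu_tuple R n.+1]_x (g x)%:E = \int[mu \x mu_tuple R n]_z (g (tcons z))%:E)%E.
Proof.
move=> ig; have mg := measurable_int _ ig; have mt := @measurable_tcons R n.
rewrite /= (integral_pushforward mt mg) ?preimage_setT//.
apply/integrableP; split; first exact: measurableT_comp.
have /integrableP[_] := ig; rewrite /= ge0_integral_pushforward ?preimage_setT//.
exact: (measurableT_comp (@abse_measurable R setT) mg).
Qed.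

Lemma ge0_integral_tcons n (g : n.+1.-tuple RR -> R) : measurable_fun setT g ->
  (forall x, 0 <= g x) ->
  (\int[mu_tuple R n.+1]_x (g x)%:E = \int[mu \x mu_tuple R n]_z (g (tcons z))%:E)%E.
Proof.
move=> mg g0; rewrite /= ge0_integral_pushforward ?preimage_setT//.
- exact: measurable_tcons.
- exact/measurable_EFinP.
- by move=> x _; rewrite lee_fin.
Qed.

Definition creation_kernel f n (z : RR * n.-tuple RR) : R := chi f z.1 * sqrt_w p q (tcons z).

Definition kern_bound f : R :=
  (`|p| + `|q| + 1) * fine (lebesgue_measure (supp f)).

Lemma measurable_kern f n : measurable_fun setT (@creation_kernel f n).
Proof.
apply: measurable_funM.
  apply: (measurableT_comp _ measurable_fst).
  apply: (@measurable_indic _ RR R setT (supp f)).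
  exact: measurable_supp.
exact: (measurableT_comp (@measurable_sqrt_w _ p q n.+1) (@measurable_tcons R n)).
Qed.

Lemma kern_bound_gt0 f : 0 < kern_bound f.
Proof.
apply: mulr_gt0; first by apply: ltr_wpDl; rewrite ?addr_ge0.
rewrite suppE lebesgue_measure_itv /= lte_fin.
by have /andP[_ h] := valP f; rewrite h /= subr_gt0.
Qed.

Lemma kern_sqr f n t : (\int[mu]_s ((@creation_kernel f n (s, t)) ^+ 2)%:E <=
  (kern_bound f)%:E)%E.
Proof.
have ms : measurable (supp f : set RR) := @measurable_supp _ f.
have C0 : 0 <= `|p| + `|q| + 1 by rewrite !addr_ge0.
apply: (@le_trans _ _ (\int[mu]_s ((`|p| + `|q| + 1)%:E * (\1_(supp f) s)%:E))%E).
  apply: ge0_le_integral => //.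
  - by move=> s _; rewrite lee_fin sqr_ge0.
  - by apply: sqr_measurable; apply: (measurableT_comp (@measurable_kern f n));
    exact: measurable_pair2.
  - by apply: measurable_funeM; apply/measurable_EFinP; exact: measurable_indic.
  move=> s _; rewrite -EFinM lee_fin /creation_kernel exprMn /chi indicE /=.
  case: (_ \in _); rewrite ?expr0n ?mul0r ?mulr0//= expr1n mul1r mulr1.
  exact: (sqr_sqrt_w_le p q (s :: t)).
rewrite ge0_integralZl_EFin//; last first.
  by apply/measurable_EFinP; exact: measurable_indic.
rewrite integral_indic// setIT /kern_bound EFinM -mu_supp.
by [].
Qed.

(** The real version of [creation_fun]. *)
Definition cre_field f u : fields := fun n =>
  if n is m.+1 then fun t => chi f (thead t) * sqrt_w p q t * u m [tuple of behead t]
  else fun=> 0.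

Definition ann_field f v : fields := fun n => kernel_op mu (@creation_kernel f n) (fun z =>
  v n.+1 (tcons z)).

Lemma sqint_tcons v n : square_summable v ->
  sqint_fun (mu \x mu_tuple R n)%E (fun z => v n.+1 (tcons z)).
Proof.
move=> sv; have [mv fv] := square_summable_sqint n.+1 sv; split.
  exact: (measurableT_comp mv (@measurable_tcons R n)).
rewrite -(ge0_integral_tcons (g := fun x => (v n.+1 x) ^+ 2))//.
- exact: measurable_funX.
- by move=> x; exact: sqr_ge0.
Qed.

Lemma ann_square_summable f v : square_summable v -> square_summable (ann_field f v).
Proof.
move=> sv; have mk n := @measurable_kern f n; have K0 := kern_bound_gt0 f.
split => [n|]; first exact: (measurable_kernel_op (mk n) (sqint_tcons n sv)).
apply: (@le_lt_trans _ _ (\sum_(0 <= n <oo) (kern_bound f)%:E *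
    \int[mu_tuple R n.+1]_x ((v n.+1 x) ^+ 2)%:E)%E).
  apply: lee_nneseries => [n _ _|n _]; first exact: sqr_int_ge0.
  have := kernel_op_sqint (mk n) K0 (@kern_sqr f n) (sqint_tcons n sv).
  rewrite -(ge0_integral_tcons (g := fun x => (v n.+1 x) ^+ 2))//.
  - by apply: measurable_funX; exact: sv.1.
  - by move=> x; exact: sqr_ge0.
rewrite nneseriesZl; last by move=> n _; exact: sqr_int_ge0.
rewrite lte_mul_pinfty ?lee_fin ?(ltW K0)//.
apply: le_lt_trans sv.2.
rewrite [leRHS]nneseries_recl//; last by move=> n _; exact: sqr_int_ge0.
rewrite -[X in (_ <= _ + X)%E]nneseries_addn; last by move=> n; exact: sqr_int_ge0.
under [X in (_ <= _ + X)%E]eq_eseriesr do rewrite addn1.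
by rewrite leeDr// sqr_int_ge0.
Qed.

Lemma cre_adjoint f u v n : square_summable u -> square_summable v ->
  square_summable (cre_field f u) ->
  \int[mu_tuple R n.+1]_x (cre_field f u x * v n.+1 x) =
  \int[mu_tuple R n]_x (u n x * ann_field f v x).
Proof.
move=> su sv scu; rewrite /Rintegral; congr fine.
rewrite (integral_tcons (pairing_integrable n.+1 scu sv)).
rewrite -(kernel_op_adjoint (@measurable_kern f n) (kern_bound_gt0 f) (@kern_sqr f n)
  (sqint_tcons n sv) (square_summable_sqint n su)).
apply: eq_integral => -[s t] _; congr EFin; congr (_ * _).
rewrite /cre_field /creation_kernel theadE /=; congr (_ * _ * u n _).
exact/val_inj.
Qed.

(** The vacuum component of a created vector is zero, so the two series agree up to
a shift of the index. *)
Lemma pairing_adjoint f u v : square_summable u -> square_summable v ->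
  square_summable (cre_field f u) ->
  pairing (cre_field f u) v = pairing u (ann_field f v).
Proof.
move=> su sv scu; have cua := pairing_cvg su (ann_square_summable f sv).
apply/cvg_lim => //; rewrite -cvg_shiftS.
rewrite (_ : [sequence _]_n = series (fun n => \int[mu_tuple R n]_x (u n x * ann_field f v x))).
  exact: cua.
apply/funext => n; rewrite /series /= big_nat_recl//.
rewrite [X in X + _](_ : _ = 0) ?add0r.
  by apply: eq_bigr => i _; exact: cre_adjoint.
rewrite /Rintegral (eq_integral (fun=> 0%E)) ?integral0//.
by move=> x _; rewrite mul0r.
Qed.

Definition fre F : fields := fun n x => complex.Re (F n x).
Definition fim F : fields := fun n x => complex.Im (F n x).

Lemma fre_square_summable F : square_summable (fre F).
Proof.
split=> [n|]; first exact: (fock_measurable F n).1.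
apply: le_lt_trans (fock_finite F).
apply: lee_nneseries => [n _ _|n _]; first exact: sqr_int_ge0.
apply: ge0_le_integral => //.
- by move=> x _; rewrite lee_fin sqr_ge0.
- by apply: sqr_measurable; exact: (fock_measurable F n).1.
- exact: measurable_sqnorm (fock_measurable F n).
- by move=> x _; rewrite lee_fin lerDl sqr_ge0.
Qed.

Lemma fim_square_summable F : square_summable (fim F).
Proof.
split=> [n|]; first exact: (fock_measurable F n).2.
apply: le_lt_trans (fock_finite F).
apply: lee_nneseries => [n _ _|n _]; first exact: sqr_int_ge0.
apply: ge0_le_integral => //.
- by move=> x _; rewrite lee_fin sqr_ge0.
- by apply: sqr_measurable; exact: (fock_measurable F n).2.
- exact: measurable_sqnorm (fock_measurable F n).
- by move=> x _; rewrite lee_fin lerDr sqr_ge0.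
Qed.

Definition complex_field u v n (x : n.-tuple RR) : R[i] := u n x +i* v n x.

Lemma complex_field_finite u v : square_summable u -> square_summable v ->
  (\sum_(0 <= n <oo) sqint (mu_tuple R n) (@complex_field u v n) < +oo)%E.
Proof.
move=> su sv.
rewrite (@eq_eseriesr _ _ (fun n => \int[mu_tuple R n]_x ((u n x) ^+ 2)%:E +
   \int[mu_tuple R n]_x ((v n x) ^+ 2)%:E)%E).
  rewrite nneseriesD; [|by move=> n _ _; exact: sqr_int_ge0..].
  by rewrite lte_add_pinfty//; [exact: su.2|exact: sv.2].
move=> n _; rewrite -ge0_integralD//.
- by move=> x _; rewrite lee_fin sqr_ge0.
- by apply: sqr_measurable; exact: su.1.
- by move=> x _; rewrite lee_fin sqr_ge0.
- by apply: sqr_measurable; exact: sv.1.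
Qed.

Definition mk_field u v (su : square_summable u) (sv : square_summable v) : fock_fun R :=
  @MkFockFun R (complex_field u v) (fun n =>
    conj (su.1 n) (sv.1 n)) (complex_field_finite su sv).

Definition annF f F : fock_fun R :=
  mk_field (ann_square_summable f (fre_square_summable F))
           (ann_square_summable f (fim_square_summable F)).

Definition creF f F : fock_fun R :=
  MkFockFun (measurable_creation p q (chi_L2 f) F) (creation_finite p q (chi_L2 f) F).

Lemma Re_realMM (a b : R) (z : R[i]) : complex.Re (a%:C * b%:C * z) = a * b * complex.Re z.
Proof. by case: z => c d /=; ring. Qed.

Lemma Im_realMM (a b : R) (z : R[i]) : complex.Im (a%:C * b%:C * z) = a * b * complex.Im z.
Proof. by case: z => c d /=; ring. Qed.

Lemma fre_creF f F : fre (creF f F) = cre_field f (fre F).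
Proof.
apply/functional_extensionality_dep => -[|n]; apply/funext => x; rewrite /fre /cre_field //=.
exact: Re_realMM.
Qed.

Lemma fim_creF f F : fim (creF f F) = cre_field f (fim F).
Proof.
apply/functional_extensionality_dep => -[|n]; apply/funext => x; rewrite /fim /cre_field //=.
exact: Im_realMM.
Qed.

Definition addF F G : fock_fun R :=
  @MkFockFun R (fun n x => F n x + G n x)
    (fun n => cmeasurableD (fock_measurable F n) (fock_measurable G n))
    (fock_add_finite F G).

Lemma fre_addF F G : fre (addF F G) = addf (fre F) (fre G).
Proof.
apply/functional_extensionality_dep => n; apply/funext => x; rewrite /fre /addf /=.
by case: (F n x) (G n x) => [a b] [c e].
Qed.

Lemma fim_addF F G : fim (addF F G) = addf (fim F) (fim G).
Proof.
apply/functional_extensionality_dep => n; apply/funext => x; rewrite /fim /addf /=.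
by case: (F n x) (G n x) => [a b] [c e].
Qed.

(** The inner product on representatives.  Working with it avoids choosing
representatives of classes at every step. *)
Definition fock_form F G : R[i] :=
  (pairing (fre F) (fre G) + pairing (fim F) (fim G)) +i*
  (pairing (fim F) (fre G) - pairing (fre F) (fim G)).

Lemma innerE (X Y : fock R) : inner X Y = fock_form (repr X) (repr Y).
Proof.
rewrite /inner /fock_form; set F := repr X; set G := repr Y.
have [sF sF'] := (fre_square_summable F, fim_square_summable F).
have [sG sG'] := (fre_square_summable G, fim_square_summable G).
congr (_ +i* _).
  rewrite /pairing -lim_seriesD; [|exact: pairing_cvg..].
  congr (limn (series _)); apply/funext => n.
  rewrite /= -[RHS]RintegralD//; [|exact: pairing_integrable..].
  apply: eq_Rintegral => x _; rewrite /fre /fim.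
  by case: (F n x) (G n x) => [a b] [c e] /=; rewrite mulrN opprK.
rewrite /pairing -lim_seriesB; [|exact: pairing_cvg..].
congr (limn (series _)); apply/funext => n.
rewrite /= -[RHS]RintegralB//; [|exact: pairing_integrable..].
apply: eq_Rintegral => x _; rewrite /fre /fim.
by case: (F n x) (G n x) => [a b] [c e] /=; rewrite mulrN addrC.
Qed.

Lemma fock_form_conj F G : fock_form F G = (fock_form G F)^*.
Proof.
rewrite /fock_form (pairingC (fre G)) (pairingC (fim G)) (pairingC (fim G) (fre F)).
rewrite (pairingC (fre G)); apply/eqP; rewrite eq_complex /= eqxx /=.
by rewrite opprB.
Qed.

Lemma fock_formDl F F' G : fock_form (addF F F') G = fock_form F G + fock_form F' G.
Proof.
rewrite /fock_form fre_addF fim_addF !pairingDl; try exact: fre_square_summable;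
  try exact: fim_square_summable.
by apply/eqP; rewrite eq_complex /=; apply/andP; split; apply/eqP; ring.
Qed.

Lemma fock_form_ae F F' G : fock_ae F F' -> fock_form F G = fock_form F' G.
Proof.
move=> /asboolP FF'; rewrite /fock_form.
have sre := fre_square_summable; have sim := fim_square_summable.
have re_ae : ae_same (fre F) (fre F').
  by move=> n; have := FF' n; apply: filterS => x; rewrite /fre => ->.
have im_ae : ae_same (fim F) (fim F').
  by move=> n; have := FF' n; apply: filterS => x; rewrite /fim => ->.
by congr (_ +i* _); [congr (_ + _)|congr (_ - _)]; apply: pairing_ae.
Qed.

Lemma fock_form_adjoint f F G : fock_form (creF f F) G = fock_form F (annF f G).
Proof.
have sre := fre_square_summable; have sim := fim_square_summable.
have h1 : square_summable (cre_field f (fre F)) by rewrite -fre_creF.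
have h2 : square_summable (cre_field f (fim F)) by rewrite -fim_creF.
by rewrite /fock_form fre_creF fim_creF !pairing_adjoint.
Qed.

End fock_forms.

(** * Vacuum expectations *)

Section moments.
Variables (R : realType) (p q : R).
Hypotheses (p0 : 0 <= p) (q0 : 0 <= q).
Local Notation RR := (measurableTypeR R).
Local Notation mu := (mu_half R).
Implicit Types (f : Theta R) (F G H : fock_fun R) (X Y : fock R).
Local Open Scope quotient_scope.

Lemma fock_repr_pi F : fock_ae (repr (\pi_(fock R) F)) F.
Proof. by apply/eqmodP; rewrite reprK. Qed.

Lemma fock_form_repr_pi F G : fock_form (repr (\pi_(fock R) F)) G = fock_form F G.
Proof. exact/fock_form_ae/fock_repr_pi. Qed.

Lemma fock_form_repr_pir F G : fock_form G (repr (\pi_(fock R) F)) = fock_form G F.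
Proof. by rewrite fock_form_conj fock_form_repr_pi -fock_form_conj. Qed.

(** The explicit annihilation operator shows that an adjoint exists, hence [xget]
returns one. *)
Lemma creation_adjoint f :
  is_adjoint (creation p q (chi_L2 f)) (adjoint (creation p q (chi_L2 f))).
Proof.
have : is_adjoint (creation p q (chi_L2 f)) (fun X => \pi_(fock R) (annF p q f (repr X))).
  move=> X Y; rewrite !innerE fock_form_repr_pir -fock_form_adjoint.
  exact: fock_form_repr_pi.
exact: xgetI.
Qed.

(** The class [X] is represented by [H], tested against all vectors.  Adjoints are
defined by such tests, so this is the form of equality that they preserve. *)
Definition weak_eq X H := forall G, fock_form (repr X) G = fock_form H G.

Definition omegaF f H := addF (creF p q f H) (annF p q f H).

(** For the annihilation part, move the chosen adjoint to a creation operator on the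
other side and back through the explicit annihilation operator. *)
Lemma omega_weak_eq f X H : weak_eq X H ->
  weak_eq (omega p q (chi_L2 f) X) (omegaF f H).
Proof.
move=> XH G; rewrite /omega /fock_add fock_form_repr_pi.
set Y := creation _ _ _ _; set Z := adjoint _ _.
rewrite -[LHS]/(fock_form (addF (repr Y) (repr Z)) G) !fock_formDl; congr (_ + _).
  by rewrite fock_form_repr_pi -[LHS]/(fock_form (creF p q f (repr X)) G) !fock_form_adjoint XH.
have -> : fock_form (repr Z) G = (inner (\pi_(fock R) G) Z)^*.
  by rewrite innerE fock_form_repr_pi fock_form_conj.
rewrite -creation_adjoint innerE fock_form_repr_pi.
rewrite -[X in X^*]/(fock_form (creF p q f (repr (\pi_(fock R) G))) (repr X)) -fock_form_conj
  XH.
by rewrite fock_form_conj fock_form_adjoint fock_form_repr_pi -fock_form_conj.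
Qed.

Definition vacF : fock_fun R := MkFockFun (@vacuum_measurable R) (@vacuum_finite R).

Fixpoint wordF (fs : seq (Theta R)) : fock_fun R :=
  if fs is f :: fs' then omegaF f (wordF fs') else vacF.

Lemma word_weak_eq fs :
  weak_eq (foldr (fun f => omega p q (chi_L2 f)) (vacuum R) fs) (wordF fs).
Proof.
elim: fs => [|f fs IH] /=; last exact: omega_weak_eq.
by move=> G; exact: fock_form_repr_pi.
Qed.

Lemma pairing_vacuum (u : forall n, n.-tuple RR -> R) : measurable_fun setT (u 0%N) ->
  pairing u (fre vacF) = u 0%N [tuple].
Proof.
move=> mu0; apply/cvg_lim => //; rewrite -cvg_shiftS.
rewrite (_ : [sequence _]_n = fun=> u 0%N [tuple]); first exact: cvg_cst.
apply/funext => n; rewrite /series /= big_nat_recl//= big1 ?addr0; last first.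
  move=> i _; rewrite /Rintegral (eq_integral (fun=> 0%E)) ?integral0//.
  by move=> x _; rewrite /fre /= /vacuum_fun /= mulr0.
rewrite /Rintegral (eq_integral (fun x => (u 0%N x)%:E)).
  rewrite integral_dirac// ?diracT ?mul1e//.
  exact/measurable_EFinP.
by move=> x _; rewrite /fre /= /vacuum_fun /= mulr1.
Qed.

Lemma pairing_vacuum_im (u : forall n, n.-tuple RR -> R) : pairing u (fim vacF) = 0.
Proof.
apply/cvg_lim => //; rewrite (_ : series _ = fun=> 0); first exact: cvg_cst.
apply/funext => n; rewrite /series /= big1// => i _.
rewrite /Rintegral (eq_integral (fun=> 0%E)) ?integral0//.
by move=> x _; rewrite /fim /= /vacuum_fun; case: (i == 0%N); rewrite /= mulr0.
Qed.

Lemma fock_form_vacuum H : fock_form H vacF = H 0%N [tuple].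
Proof.
rewrite /fock_form !pairing_vacuum_im !pairing_vacuum;
  [|exact: (fock_measurable H 0).2|exact: (fock_measurable H 0).1].
by rewrite addr0 subr0 /fre /fim; case: (H 0%N _).
Qed.

(** The factor that every vector of the form [wordF fs] contains. *)
Fixpoint sqrt_w_prod (x : seq R) : R := if x is s :: x' then sqrt_w p q x * sqrt_w_prod x'
  else 1.

Lemma sqrt_w_prod_cons s x : sqrt_w_prod (s :: x) = sqrt_w p q (s :: x) * sqrt_w_prod x.
Proof. by []. Qed.

Lemma creation_kernelE f n (s : R) (t : n.-tuple RR) :
  creation_kernel p q f (s, t) = chi f s * sqrt_w p q (s :: t).
Proof. by []. Qed.

Lemma sqrt_w_ge0 x : 0 <= sqrt_w p q x.
Proof. by case: x => [|s [|t x]] //=; exact: sqrtr_ge0. Qed.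

Lemma sqrt_w_prod_ge0 x : 0 <= sqrt_w_prod x.
Proof. by elim: x => [//|s x IH] /=; apply: mulr_ge0 => //; exact: (sqrt_w_ge0 (s :: x)). Qed.

Definition chis (fs : seq (Theta R)) := [seq chi f | f <- fs].

Lemma tonelli_chis fs : tonelli (moment p q (chis fs)).
Proof.
apply: tonelli_moment => // g; elim: fs => [//|f fs IH] /= [<-|//]; exact: good_chi.
Qed.

Lemma int_chi f : (\int[mu]_s (chi f s)%:E = (fine (lebesgue_measure (supp f)))%:E)%E.
Proof.
have ms : measurable (supp f : set RR) := @measurable_supp _ f.
by rewrite /chi integral_indic// setIT; exact: mu_supp.
Qed.

Lemma measurable_EFin_chi f : measurable_fun [set: RR] (fun s : RR => (chi f s)%:E).
Proof. by apply/measurable_EFinP; exact: (good_chi f).2. Qed.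

(** Needed to know that the integrals in [moment] are finite at every point, and not
only almost everywhere. *)
Lemma moment_bounded fs : exists2 M : R, 0 <= M & forall t, (moment p q (chis fs) t <= M%:E)%E.
Proof.
elim: fs => [|f fs [M M0 hM]]; first by exists 1 => // t; rewrite /= lee_fin; case: eqP.
pose C := `|p| + `|q| + 1; have C0 : 0 <= C by rewrite !addr_ge0.
have wC x : w_head p q x <= C by rewrite -sqr_sqrt_w//; exact: sqr_sqrt_w_le.
pose l := fine (lebesgue_measure (supp f)).
have l0 : 0 <= l by exact: fine_ge0.
exists (C * M * l + M) => [|t]; first by rewrite addr_ge0 ?mulr_ge0.
have th := tonelli_chis fs.
rewrite [chis _]/= moment_cons EFinD; apply: leeD.
  rewrite EFinM -int_chi -ge0_integralZl_EFin ?mulr_ge0//; last 2 first.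
  - by move=> s _; rewrite lee_fin (good_chi f).1.
  - exact: measurable_EFin_chi.
  have tK := tonelliM (tonelli_w p0 q0) th.
  apply: ge0_le_integral => //.
  - by move=> s _; rewrite mule_ge0 ?lee_fin ?(good_chi f).1//; exact: tK.1.
  - apply: emeasurable_funM; first exact: measurable_EFin_chi.
    exact: (measurable_cons_cst t tK).
  - by apply: measurable_funeM; exact: measurable_EFin_chi.
  move=> s _; rewrite muleC lee_wpmul2r ?lee_fin ?(good_chi f).1// EFinM.
  by apply: lee_pmul; rewrite ?lee_fin ?w_head_ge0 ?wC//; exact: th.1.
case: t => [|s t]; first by rewrite lee_fin.
rewrite -[leRHS]mul1e; apply: lee_pmul => //; first by rewrite lee_fin (good_chi f).1.
- exact: th.1.
- by rewrite lee_fin /chi indicE; case: (_ \in _).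
Qed.

(** A creation and the later annihilation of a variable contribute [sqrt w] each; the
first is absorbed in [sqrt_w_prod] and the annihilation integrates against the
product of both, which is [w]. *)
Lemma wordF_value fs n (t : n.-tuple RR) : complex.Im (wordF fs n t) = 0 /\
  (complex.Re (wordF fs n t))%:E = ((sqrt_w_prod t)%:E * moment p q (chis fs) t)%E.
Proof.
elim: fs n t => [|f fs IH] n t.
  rewrite /= /vacuum_fun; case: n t => [|n] t; rewrite /=.
    by rewrite tuple0 /= mule1.
  by case: t => [[|s t]//= _]; rewrite mule0.
have annE (u := fre (wordF fs)) :
    (ann_field p q f u t)%:E =
    ((sqrt_w_prod t)%:E * \int[mu]_s ((chi f s)%:E * ((w_head p q (s :: t))%:E *
      moment p q (chis fs) (s :: t))))%E.
  have [M M0 hM] := moment_bounded (f :: fs).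
  have tK := tonelliM (tonelli_w p0 q0) (tonelli_chis fs).
  have K0 s : (0 <= (chi f s)%:E * ((w_head p q (s :: t))%:E * moment p q (chis fs) (s ::
    t)))%E.
    by rewrite mule_ge0 ?lee_fin ?(good_chi f).1//; exact: tK.1.
  have E : (\int[mu]_s (creation_kernel p q f (s, t) * u n.+1 (tcons (s, t)))%:E =
    (sqrt_w_prod t)%:E *
      \int[mu]_s ((chi f s)%:E * ((w_head p q (s :: t))%:E * moment p q (chis fs) (s :: t))))%E.
    rewrite -ge0_integralZl_EFin ?sqrt_w_prod_ge0//; last first.
      apply: emeasurable_funM; first exact: measurable_EFin_chi.
      exact: (measurable_cons_cst t tK).
    apply: eq_integral => s _; rewrite EFinM (IH n.+1 (tcons (s, t))).2 creation_kernelE.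
    rewrite -[tval (tcons (s, t))]/(s :: tval t) sqrt_w_prod_cons -sqr_sqrt_w// expr2 !EFinM.
    rewrite !muleA; congr (_ * _)%E; rewrite -!EFinM; congr EFin; ring.
  rewrite /ann_field /kernel_op /Rintegral fineK E//.
  rewrite fin_numM// ge0_fin_numE; last by apply: integral_ge0 => s _.
  apply: le_lt_trans (ltry M); apply: le_trans (hM t).
  rewrite [chis _]/= moment_cons leeDl//; case: (tval t) => [//|s x].
  by rewrite mule_ge0 ?lee_fin ?(good_chi f).1//; exact: (tonelli_chis fs).1.
rewrite [wordF _]/= /omegaF.
have -> : complex.Re (addF (creF p q f (wordF fs)) (annF p q f (wordF fs)) n t) =
    cre_field p q f (fre (wordF fs)) t + ann_field p q f (fre (wordF fs)) t.
  by rewrite -[LHS]/(fre (addF _ _) t) fre_addF /addf fre_creF.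
have -> : complex.Im (addF (creF p q f (wordF fs)) (annF p q f (wordF fs)) n t) =
    cre_field p q f (fim (wordF fs)) t + ann_field p q f (fim (wordF fs)) t.
  by rewrite -[LHS]/(fim (addF _ _) t) fim_addF /addf fim_creF.
split.
  have -> : ann_field p q f (fim (wordF fs)) t = 0.
    rewrite /= /ann_field /kernel_op /Rintegral (eq_integral (fun=> 0%E)) ?integral0//.
    by move=> s _; rewrite /fim (IH _ _).1 mulr0.
  rewrite addr0; case: n t {annE} => [//|n] t.
  by rewrite /cre_field /fim (IH _ _).1 mulr0.
rewrite EFinD.
rewrite annE [chis _]/= moment_cons [RHS]ge0_muleDr; last 2 first.
- by apply: integral_ge0 => s _; rewrite mule_ge0 ?lee_fin ?(good_chi f).1// mule_ge0
  ?lee_fin ?w_head_ge0//; exact: (tonelli_chis fs).1.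
- case: (tval t) => [//|s x].
  by rewrite mule_ge0 ?lee_fin ?(good_chi f).1//; exact: (tonelli_chis fs).1.
rewrite addeC; congr (_ + _)%E.
case: n t {annE} => [|n] t; first by rewrite tuple0 /= mule0.
rewrite /cre_field /fre EFinM (IH n [tuple of behead t]).2.
case: t => [[//|s x] /= st]; rewrite /thead (tnth_nth 0) /=.
by rewrite muleA -EFinM [RHS]muleA -EFinM; congr (_%:E * _)%E; ring.
Qed.

Lemma vacuum_state_word fs (v : R) : moment p q (chis fs) [::] = v%:E ->
  vacuum_state (foldr (fun f => omega p q (chi_L2 f)) ^~ fs) = v%:C.
Proof.
move=> hv; rewrite /vacuum_state innerE.
rewrite (word_weak_eq fs) /vacuum fock_form_repr_pir fock_form_vacuum.
have := wordF_value fs [tuple]; rewrite /= mul1e hv.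
by case: (wordF fs 0%N _) => a b /= [-> [->]].
Qed.

End moments.

Lemma big_comp_foldr (I T : Type) (r : seq I) (A : I -> T -> T) x :
  (\big[(fun S T' : T -> T => S \o T')/idfun]_(i <- r) A i) x = foldr A x r.
Proof. by elim: r => [|i r IH]; rewrite ?big_nil// big_cons /= IH. Qed.

Theorem theorem3p1 (R : realType) (p q : R) (hp : 0 <= p) (hq : 0 <= q)
    (n : nat) (f : 'I_n -> Theta R)
    (hf : forall i j : 'I_n,
      supp (f i) = supp (f j) \/ supp (f i) `&` supp (f j) = set0)
    (r : nat) (I : 'I_r -> set R)
    (hI_lt : forall i j : 'I_r, (i < j)%N -> set_lt (I i) (I j))
    (hI_range : range I = range (fun j : 'I_n => supp (f j))) :
  let b (i : 'I_r) : nat := (#|[pred j : 'I_n | `[< supp (f j) = I i >] ]|./2)%N in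
  vacuum_state (\big[(fun S T : fock R -> fock R => S \o T)/idfun]_(i < n)
      omega p q (chi_L2 (f i))) =
  (\prod_(i < r) (fine (lebesgue_measure (I i)) ^+ b i / (b i)`!%:R) *
   \sum_(P : n.-bseq {set 'I_n} | ONC2 P && `[< adapted f P >])
      weight p q P)%:C.
Proof.
move=> b; have := word_value hp hq hI_lt hI_range.
have -> : remaining_letters n (letter f) 0 = chis [seq f i | i <- enum 'I_n].
  rewrite /remaining_letters /chis subn0 -val_enum_ord -!map_comp; apply: eq_map => i /=.
  exact: letterE.
move=> /(vacuum_state_word hp hq) <-; congr vacuum_state; apply/funext => X.
rewrite [index_enum _]unlock -enumT big_comp_foldr.
by elim: (enum 'I_n) => [//|i s IH] /=; rewrite IH.
Qed.
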